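(* For all integers $d\ge2$ and all $r\in(0,1)$, the following upper bounds hold. (i) When $d=2$: there is a universal constant $K>0$ such that for all $r\in(0,1)$, $\liminf_{\lambda\to\infty}m_2(\lambda,r)\le K r^2$. (ii) When $d=3$: there are universal constants $K,C>0$ such that for all $r\in(0,1)$, $$\liminf_{\lambda\to\infty}m_3(\lambda,r)\le K\exp\Bigl\{-\exp\Bigl(\frac{C\ln(1/r)}{\ln\ln(1/r)}\Bigr)\Bigr\}.$$ (iii) When $d\ge4$: there is a universal constant $K>0$ and, for every integer $d\ge4$, a constant $C_d>0$ depending only on $d$, such that for all $r\in(0,1)$, $$\liminf_{\lambda\to\infty}m_d(\lambda,r)\le K\exp\bigl\{-C_d\,r^{3-d}\bigr\}.$$
   Context: Let $\mathbb{T}^d=\mathbb{R}^d/(2\pi\mathbb{Z})^d$ and $\mathcal{E}_d(\lambda)=\{u\in C^\infty(\mathbb{T}^d): -\Delta u=\lambda^2u\}$. Throughout, $\lambda\ge0$ ranges over the values with $\lambda^2\in\mathbb{N}$ and $\mathcal{E}_d(\lambda)\ne\{0\}$; in particular $\liminf_{\lambda\to\infty}$ is along these values. Write $\fint_\Omega f\,dx=\frac{1}{|\Omega|}\int_\Omega f\,dx$, $B_r=\{x\in\mathbb{R}^d:|x|<r\}$, and regard functions on $\mathbb{T}^d$ as periodic functions on $\mathbb{R}^d$. The observability constant is $$m_d(\lambda,r)=\inf_{0\ne u\in\mathcal{E}_d(\lambda)}\frac{\fint_{B_r}|u(x)|^2\,dx}{\fint_{\mathbb{T}^d}|u(x)|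^2\,dx}.$$
   Formalization: In (ii), the bound is undefined at r=1/e and fails for universal K as r increases to 1/e; it is proved instead with C universal and, for each r0<1/e, a K depending on r0, for all r in (0,1) with r≤r0 or r>1/e. *)

(* Defs.v *)
From HB Require Import structures.
From mathcomp Require Import all_boot all_order all_algebra complex.
From mathcomp Require Import all_classical all_reals all_analysis.

Set Implicit Arguments.
Unset Strict Implicit.
Unset Printing Implicit Defensive.
Import Order.TTheory GRing.Theory Num.Theory.
Import numFieldNormedType.Exports.
Local Open Scope classical_set_scope.
Local Open Scope ring_scope.

Section tuple_measure.
Context d (T : measurableType d) (R : realType).

Definition tcons n (p : T * n.-tuple T) : n.+1.-tuple T :=
  [the n.+1.-tuple T of p.1 :: p.2].

Definition tuncons n (t : n.+1.-tuple T) : T * n.-tuple T :=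
  (tnth t ord0, [tuple of behead t]).

Lemma tconsK n : cancel (@tcons n) (@tuncons n).
Proof.
by case=> x t; rewrite /tuncons /tcons/= tnth0; congr pair; apply/val_inj.
Qed.

Lemma measurable_tcons n : measurable_fun [set: T * n.-tuple T] (@tcons n).
Proof. exact: measurable_cons. Qed.

Lemma measurable_tuncons n : measurable_fun [set: n.+1.-tuple T] (@tuncons n).
Proof.
apply/measurable_fun_pairP; split; first exact: measurable_tnth.
exact: measurable_behead.
Qed.

Section step.
Context (m1 : {sigma_finite_measure set T -> \bar R}) (n : nat).
Context (m2 : {sigma_finite_measure set (n.-tuple T) -> \bar R}).

Definition tcons_measure : set (n.+1.-tuple T) -> \bar R :=
  pushforward (m1 \x m2)%E (@tcons n).

Let pushforward_tcons : {measure set (n.+1.-tuple T) -> \bar R} :=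
  measure_function_pushforward__canonical__measure_function_Measure
    (m1 \x m2)%E (@measurable_tcons n).

HB.instance Definition _ := isMeasure.Build _ _ _ tcons_measure
  (measure0 pushforward_tcons) (measure_ge0 pushforward_tcons)
  (@measure_semi_sigma_additive _ _ _ pushforward_tcons).

Lemma sigma_finite_tcons_measure : sigma_finite setT tcons_measure.
Proof.
have /sigma_finiteP[F [FT ndF Foo]] := sigma_finiteT m1.
have /sigma_finiteP[G [GT ndG Goo]] := sigma_finiteT m2.
exists (fun k => @tuncons n @^-1` (F k `*` G k)).
  rewrite -preimage_bigcup (_ : \bigcup_k _ = setT) ?preimage_setT//.
  rewrite -subTset => -[x y] _.
  have [i _ Fix] : (\bigcup_i F i) x by rewrite -FT.
  have [j _ Gjy] : (\bigcup_i G i) y by rewrite -GT.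
  exists (maxn i j) => //; split => /=.
    by move: x Fix; exact/subsetPset/ndF/leq_maxl.
  by move: y Gjy; exact/subsetPset/ndG/leq_maxr.
move=> k; have [mF Fk] := Foo k; have [mG Gk] := Goo k; split.
  rewrite -[X in measurable X]setTI; apply: measurable_tuncons => //.
  exact: measurableX.
rewrite /tcons_measure /pushforward -comp_preimage.
rewrite (_ : _ \o _ = id); last by apply/funext => p; exact: tconsK.
by rewrite preimage_id product_measure1E// lte_mul_pinfty// ge0_fin_numE.
Qed.

HB.instance Definition _ := Measure_isSigmaFinite.Build _ _ _ tcons_measure
  sigma_finite_tcons_measure.

End step.

(* The n-fold product of [m]. *)
Fixpoint tuple_measure (m : {sigma_finite_measure set T -> \bar R}) n :
    {sigma_finite_measure set (n.-tuple T) -> \bar R} :=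
  match n with
  | 0 => \d_ [tuple]
  | n'.+1 => tcons_measure m (tuple_measure m n')
  end.

End tuple_measure.

(* Lebesgue measure on the Borel sets of R^n. The carrier is [n.-tuple _] since
   this is the type that the library endows with the product sigma-algebra. *)
Definition lebesgue_tuple (R : realType) (n : nat) :=
  tuple_measure (@lebesgue_measure R) n.

Section torus.
Context {R : realType}.
Local Open Scope complex_scope.

Definition partial d (i : 'I_d) (u : 'rV[R]_d -> R[i]) (x : 'rV[R]_d) : R[i] :=
  'D_(delta_mx 0 i) (fun y => complex.Re (u y)) x +i*
  'D_(delta_mx 0 i) (fun y => complex.Im (u y)) x.

Definition has_partial d (i : 'I_d) (u : 'rV[R]_d -> R[i]) :=
  forall x, derivable (fun y => complex.Re (u y)) x (delta_mx 0 i) /\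
            derivable (fun y => complex.Im (u y)) x (delta_mx 0 i).

Definition partials d (s : seq 'I_d) (u : 'rV[R]_d -> R[i]) :=
  foldr (@partial d) u s.

(* C^oo: all iterated partial derivatives exist and are continuous. *)
Definition smooth d (u : 'rV[R]_d -> R[i]) :=
  forall s : seq 'I_d,
    [/\ continuous (fun x => complex.Re (partials s u x)),
        continuous (fun x => complex.Im (partials s u x)) &
        forall i, has_partial i (partials s u)].

Definition laplacian d (u : 'rV[R]_d -> R[i]) (x : 'rV[R]_d) : R[i] :=
  \sum_(i < d) partials [:: i; i] u x.

Definition periodic d (u : 'rV[R]_d -> R[i]) :=
  forall (x : 'rV[R]_d) (k : 'rV[int]_d),
    u (x + (2 * pi) *: map_mx intr k) = u x.

(* The real number [lam], not its square, indexes the laplace_eigenspace. *)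
Definition laplace_eigenspace d (lam : R) : set ('rV[R]_d -> R[i]) :=
  [set u | [/\ periodic u, smooth u &
     forall x, - laplacian u x = (lam ^+ 2)%:C * u x]].
Arguments laplace_eigenspace d lam : clear implicits.

Definition frequencies d : set R :=
  [set lam | [/\ 0 <= lam, exists n : nat, lam ^+ 2 = n%:R &
     exists2 u, laplace_eigenspace d lam u & u <> (fun=> 0)]].

Definition row_of_tuple d (t : d.-tuple (measurableTypeR R)) : 'rV[R]_d :=
  \row_i tnth t i.

Definition average d (Omega : set 'rV[R]_d) (f : 'rV[R]_d -> R) : R :=
  let D := @row_of_tuple d @^-1` Omega in
  (fine (lebesgue_tuple R d D))^-1 *
  \int[lebesgue_tuple R d]_(t in D) f (row_of_tuple t).

(* The norm of ['rV[R]_d] is the sup norm, hence the explicit Euclidean one. *)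
Definition eball d (r : R) : set 'rV[R]_d :=
  [set x | Num.sqrt (\sum_(i < d) x 0 i ^+ 2) < r].
Arguments eball d r : clear implicits.

(* A fundamental domain of R^d / (2 pi Z)^d. *)
Definition torus_cell d : set 'rV[R]_d :=
  [set x | forall i, 0 <= x 0 i < 2 * pi].
Arguments torus_cell d : clear implicits.

Definition sqmod (z : R[i]) : R := complex.Re z ^+ 2 + complex.Im z ^+ 2.

Definition observability d (lam r : R) : \bar R :=
  ereal_inf [set (average (eball d r) (sqmod \o u) /
                  average (torus_cell d) (sqmod \o u))%:E
            | u in [set u | laplace_eigenspace d lam u /\ u <> (fun=> 0)]].

Definition liminf_observability d (r : R) : \bar R :=
  limf_einf (fun lam => observability d lam r)
    (within (frequencies d) (pinfty_nbhs R)).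

End torus.

(* Main.v *)
(* A function [u] with frequencies [(n, p_j)], where the [p_j] are fixed integer
   points on the sphere [|p| ^ 2 = q] of one dimension less, is an eigenfunction
   with eigenvalue [n ^ 2 + q], and [|u|] does not depend on [n]; so letting [n]
   go to infinity bounds the lower limit by the quotient of this single [u].
   On the sphere every polynomial of degree less than [k] is a combination of
   [2 * k ^ (d - 2)] monomials, so that many plus one frequencies suffice to make
   [u] vanish to order [k] on the line through the origin along the first axis,
   and by Taylor's formula the quotient is at most [2 N ((sqrt q * r) ^ k / k!) ^ 2], where [N] is the number of
   frequencies. This is of size [exp (- k)] as soon as [sqrt q * r <= k / e ^ 2].
   For [d >= 4] the pigeonhole principle gives, for every [a], spheres of radius
   [O(a ^ (d - 2))] with more than [2 * k ^ (d - 2)] points for [k = a ^ (d - 3)],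
   and one takes [a] of order [1 / r]. For [d = 3] one needs circles with many
   points: [T] distinct primes [p = 1 mod 4] give [2 ^ T] roots of [-1] modulo
   their product, hence [2 ^ T] points by Thue's lemma, and enough such primes of
   polynomial size in [T] divide the product of the [m ^ 2 + 1]. For [d = 2] take
   [u(x, y) = 2 i * exp(i n x) * sin y]. *)

Require Import Defs.
From HB Require Import structures.
From mathcomp Require Import all_boot all_order all_algebra complex.
From mathcomp Require Import all_classical all_reals all_analysis.
From mathcomp Require Import measurable_realfun.
From mathcomp Require Import zify ring lra.

Set Implicit Arguments.
Unset Strict Implicit.
Unset Printing Implicit Defensive.
Import Order.TTheory GRing.Theory Num.Theory.
Import numFieldNormedType.Exports.

(** * Circles with many lattice points *)

Lemma logn_prod (I : Type) p (r : seq I) (P : pred I) (F : I -> nat) :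
  (forall i, P i -> 0 < F i) ->
  logn p (\prod_(i <- r | P i) F i) = \sum_(i <- r | P i) logn p (F i).
Proof.
move=> F0; suff [] : (0 < \prod_(i <- r | P i) F i) /\
  logn p (\prod_(i <- r | P i) F i) = \sum_(i <- r | P i) logn p (F i) by [].
apply: (big_rec2 (fun a b => 0 < a /\ logn p a = b)); first by rewrite logn1.
move=> i a b Pi [a0 <-]; split; first by rewrite muln_gt0 F0.
by rewrite lognM // F0.
Qed.

Lemma leq_predn_logn_fact p n : prime p -> p.-1 * logn p n`! <= n.
Proof.
move=> p_pr; rewrite logn_fact // big_distrr /=.
(* The added term makes the induction telescope, since p times n %/ p^(m+1) is at most n %/ p^m. *)
suff: forall m, \sum_(1 <= k < m.+1) p.-1 * (n %/ p ^ k) + n %/ p ^ m <= n.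
  by move=> /(_ n); apply: leq_trans; rewrite leq_addr.
elim=> [|m IH]; first by rewrite big_nil expn0 divn1.
rewrite big_nat_recr //=; apply: leq_trans IH.
rewrite -addnA leq_add2l -mulSnr prednK ?prime_gt0 //.
by rewrite expnSr divnMA mulnC leq_trunc_div.
Qed.

Lemma leq_divn_logn_fact p n : prime p -> n %/ p <= logn p n`!.
Proof.
move=> p_pr; case: n => [|n]; first by rewrite div0n.
by rewrite logn_fact // big_ltn // expn1 leq_addr.
Qed.

Lemma logn_fact_sum p n : logn p n`! = \sum_(1 <= j < n.+1) logn p j.
Proof.
by rewrite fact_prod big_nat [in RHS]big_nat logn_prod // => i /andP[].
Qed.

Definition sq1prod X := \prod_(1 <= m < X.+1) (m ^ 2 + 1).

Lemma sq1prod_gt0 X : 0 < sq1prod X.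
Proof. by rewrite /sq1prod; elim/big_rec: _ => // i x _ x0; rewrite muln_gt0 x0 addn1. Qed.

(* If [m0] maximizes the [p]-adic valuation of [m ^ 2 + 1], then the power of
   [p] in any other factor divides [m ^ 2 - m0 ^ 2 = (m - m0) * (m + m0)]. *)
Lemma logn_sq1prod p X : prime p -> 0 < X ->
  exists2 m, m <= X & logn p (sq1prod X) <=
    logn p (m ^ 2 + 1) + (logn p X`! + logn p X`! + logn p (2 * X)`!).
Proof.
move=> p_pr X0.
pose f m := logn p (m ^ 2 + 1).
have [m0 [m01 m0X max]] : exists m0, [/\ 1 <= m0, m0 <= X &
    forall m, 1 <= m <= X -> f m <= f m0].
  have i0 : 'I_X := Ordinal X0.
  case: (@arg_maxnP _ i0 predT (fun i : 'I_X => f i.+1)) => // i _ im.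
  exists i.+1; split => // m /andP[m1 mX].
  have mX' : m.-1 < X by case: m m1 mX.
  by have := im (Ordinal mX') isT; rewrite /= prednK.
have X1 : 0 < X.+1 by [].
(* Subtraction is truncated, so the sum of the two opposite differences is |m - m0|. *)
have bnd m : 1 <= m <= X -> m != m0 ->
    f m <= logn p ((m - m0) + (m0 - m)) + logn p (m + m0).
  move=> mX mm0; have := max m mX; rewrite /f => le.
  have d1 : p ^ f m %| m ^ 2 + 1 by rewrite pfactor_dvdnn.
  have d2 : p ^ f m %| m0 ^ 2 + 1.
    by rewrite pfactor_dvdn // addn1.
  rewrite -lognM; [|lia|lia].
  have -> : (m - m0 + (m0 - m)) * (m + m0) =
            (m ^ 2 + 1 - (m0 ^ 2 + 1)) + ((m0 ^ 2 + 1) - (m ^ 2 + 1)) by nia.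
  rewrite -pfactor_dvdn //; last by nia.
  by rewrite dvdn_add // dvdn_sub.
exists m0 => //.
rewrite /sq1prod logn_prod; last by move=> i _; rewrite addn1.
rewrite (bigD1_seq m0) /=; last 2 first.
- by rewrite mem_index_iota; lia.
- by rewrite iota_uniq.
rewrite leq_add2l.
apply: (@leq_trans (\sum_(1 <= m < X.+1 | m != m0)
   (logn p ((m - m0) + (m0 - m)) + logn p (m + m0)))).
  rewrite big_nat_cond [leqRHS]big_nat_cond; apply: leq_sum => i.
  by rewrite ltnS => /andP[/bnd]; apply.
(* On either side of m0 the numbers |m - m0| are distinct and at most X, and the m + m0 are distinct
   and at most 2 X; this gives the three factorials. *)
rewrite big_split /=; apply: leq_add.
  apply: (@leq_trans (\sum_(1 <= m < X.+1) logn p ((m - m0) + (m0 - m)))).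
    by rewrite [leqRHS](bigID (fun m => m != m0)) /= leq_addr.
  rewrite (big_cat_nat (n := m0)) //=; last by lia.
  apply: leq_add.
    rewrite big_nat_rev /= logn_fact_sum.
    rewrite [leqRHS](big_cat_nat (n := m0)) //=; last by lia.
    apply: leq_trans (leq_addr _ _).
    rewrite big_nat [leqRHS]big_nat; apply: leq_sum => i ib.
    by have -> : 1 + m0 - i.+1 - m0 + (m0 - (1 + m0 - i.+1)) = i by lia.
  rewrite logn_fact_sum big_ltn; last by lia.
  (* The term m = m0, put back to simplify the range, is harmless because [logn p 0 = 0]. *)
  rewrite subnn addn0 logn0 add0n.
  have -> : X.+1 = (X - m0).+1 + m0 by lia.
  rewrite -[m0.+1]/(1 + m0) big_addn addnK.
  rewrite [leqRHS](big_cat_nat (n := (X - m0).+1)) //=; last by lia.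
  apply: leq_trans (leq_addr _ _).
  rewrite big_nat [leqRHS]big_nat; apply: leq_sum => i ib.
  by have -> : i + m0 - m0 + (m0 - (i + m0)) = i by lia.
apply: (@leq_trans (\sum_(1 <= m < X.+1) logn p (m + m0))).
  by rewrite [leqRHS](bigID (fun m => m != m0)) /= leq_addr.
rewrite logn_fact_sum [leqRHS](big_cat_nat (n := 1 + m0)) //=; last by lia.
rewrite [leqRHS]addnC; apply: leq_trans (leq_addr _ _).
rewrite big_addn.
rewrite [leqRHS](big_cat_nat (n := X.+1)) /=; [|lia|lia].
exact: leq_addr.
Qed.

(** Pair the factor i + 1 of one factorial with the factor n - i of the other: their product is at
    least n. *)
Lemma expn_self_leq_fact n : n ^ n <= n`! * n`!.
Proof.
have E : n`! = \prod_(i < n) i.+1.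
  by rewrite fact_prod big_add1 /= big_mkord.
rewrite {1}E {1}E [X in X * _](reindex_inj rev_ord_inj) -big_split /=.
rewrite -[X in X <= _](_ : \prod_(i < n) n = _); last by rewrite prod_nat_const card_ord.
apply: leq_prod => i _; have := ltn_ord i; nia.
Qed.

Lemma sq1prod_gt_expn X : 0 < X -> X ^ X < sq1prod X.
Proof.
move=> X0; apply: (leq_ltn_trans (expn_self_leq_fact X)).
have aux m : m`! * m`! <= sq1prod m.
  elim: m => [|m IH]; first by rewrite /sq1prod big_nil.
  rewrite factS /sq1prod big_nat_recr //= -/(sq1prod m).
  have : (m.+1 ^ 2 <= m.+1 ^ 2 + 1) by lia.
  by move: IH; nia.
case: X X0 => // m _.
rewrite factS /sq1prod big_nat_recr //= -/(sq1prod m).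
have := aux m; have := fact_gt0 m; nia.
Qed.

Lemma dvdn_sq1prod p X : prime p -> p %| sq1prod X ->
  exists2 m, m <= X & p %| m ^ 2 + 1.
Proof.
move=> p_pr; rewrite /sq1prod; elim: X => [|X IH].
  by rewrite big_nil dvdn1 => /eqP p1; rewrite p1 in p_pr.
rewrite big_nat_recr //= Euclid_dvdM // => /orP[/IH[m mX pm]|pX].
  by exists m => //; lia.
by exists X.+1.
Qed.

Lemma prod_primes_logn n : 0 < n -> n = \prod_(p <- primes n) p ^ logn p n.
Proof.
move=> n0; rewrite {1}(prod_prime_decomp n0) prime_decompE big_map.
by apply: eq_bigr.
Qed.

Lemma prod_expn_const (I : eqType) (r : seq I) (P : pred I) a :
  0 < a -> \prod_(i <- r | P i) a <= a ^ size r.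
Proof.
move=> a0; rewrite big_const_seq iter_muln_1.
by case: a a0 => // a _; rewrite leq_pexp2l // count_size.
Qed.

(** Few prime divisors force a small product. A prime p contributes one factor of size at most M =
    X^2 + 1 and a remaining exponent W with (p - 1) W <= 4 X. If p > Y then W <= 4 q, which costs a
    power of M for each prime; the primes p <= Y together contribute at most a power of Y!. *)
Lemma sq1prod_leq Y q X (l := primes (sq1prod X)) :
  1 < Y -> 0 < q -> X = q * Y -> 30 * size l <= Y ->
  sq1prod X ^ 2 <= X ^ X * Y ^ (32 * X).
Proof.
move=> Y1 q0 XE.
have [T TE] : exists T, T = size l by exists (size l).
rewrite -TE => small.
have Y0 : 0 < Y by lia.
have X0 : 0 < X by rewrite XE muln_gt0 q0.
have YX : Y <= X by rewrite XE leq_pmull.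
have X1 : 1 < X by lia.
have P0 : 0 < sq1prod X := sq1prod_gt0 X.
have [M ME] : exists M, M = X ^ 2 + 1 by exists (X ^ 2 + 1).
have M0 : 0 < M by lia.
(* For p <= Y one has Y <= 4 (p - 1) (Y %/ p), and Y %/ p is at most the valuation of Y!; so W <= 4
   q Y / (p - 1) is at most 16 q times that valuation. *)
pose w p := (p <= Y) * (16 * q * logn p Y`!).
have bnd p : p \in l -> p ^ logn p (sq1prod X) <= M ^ (5 * q) * p ^ w p.
  rewrite mem_primes => /and3P[p_pr _ pP].
  have p1 := prime_gt1 p_pr.
  have [m' m'X pm'] := dvdn_sq1prod p_pr pP.
  have pM : p <= M.
    apply: (leq_trans (dvdn_leq _ pm')); first by lia.
    by rewrite ME leq_add2r leq_exp2r.
  have [m mX] := logn_sq1prod p_pr X0.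
  set a := logn p (m ^ 2 + 1) => le.
  have f1 := leq_predn_logn_fact X p_pr.
  have f2 := leq_predn_logn_fact (2 * X) p_pr.
  set W := (_ + _ + _) in le.
  have WX : p.-1 * W <= 4 * X by rewrite /W; lia.
  have aM : p ^ a <= M.
    apply: (@leq_trans (m ^ 2 + 1)); last by rewrite ME leq_add2r leq_exp2r.
    by apply: dvdn_leq; [lia|rewrite pfactor_dvdnn].
  apply: (@leq_trans (p ^ (a + W))); first by rewrite leq_pexp2l // ltnW.
  rewrite expnD (_ : 5 * q = q + 4 * q); last by lia.
  rewrite expnD -mulnA; apply: leq_mul.
    by apply: (leq_trans aM); rewrite -{1}[M]expn1 leq_pexp2l.
  rewrite /w; case: (leqP p Y) => [pY|Yp]; rewrite ?mul0n ?mul1n.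
    apply: (@leq_trans (p ^ (16 * q * logn p Y`!))); last first.
      by rewrite leq_pmull // expn_gt0 M0.
    rewrite leq_pexp2l //; first by lia.
    have g := leq_divn_logn_fact Y p_pr.
    have h : Y < p * (Y %/ p).+1 by rewrite mulnC ltn_ceil //; lia.
    have Yp0 : 0 < Y %/ p by rewrite divn_gt0 //; lia.
    rewrite -(@leq_pmul2l p.-1); last by lia.
    apply: (leq_trans WX); rewrite XE.
    have h1 : Y <= 4 * (p.-1 * (Y %/ p)) by nia.
    have h2 : Y <= 4 * (p.-1 * logn p Y`!).
      apply: (leq_trans h1); rewrite leq_pmul2l // leq_mul2l g orbT //.
    have := leq_mul (leqnn (4 * q)) h2; lia.
  rewrite expn0 muln1.
  apply: (@leq_trans (p ^ (4 * q))); last by rewrite leq_exp2r //; lia.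
  rewrite leq_pexp2l //; first by lia.
  rewrite -(@leq_pmul2l Y) //.
  apply: (@leq_trans (p.-1 * W)); first by rewrite leq_mul2r; lia.
  by apply: (leq_trans WX); rewrite XE; lia.
have Pup : sq1prod X <= M ^ (5 * q * T) * Y ^ (16 * X).
  rewrite {1}(prod_primes_logn P0) -/l.
  apply: (@leq_trans (\prod_(p <- l) (M ^ (5 * q) * p ^ w p))).
    by rewrite big_seq [leqRHS]big_seq; apply: leq_prod => i; exact: bnd.
  rewrite big_split /=; apply: leq_mul.
    by rewrite [leqRHS]expnM TE; apply: prod_expn_const; rewrite expn_gt0 M0.
  have -> : \prod_(p <- l) p ^ w p =
            (\prod_(p <- l | p <= Y) p ^ logn p Y`!) ^ (16 * q).
    rewrite (big_morph (fun x => x ^ (16 * q)) (fun x y => expnMn x y _) (exp1n _)).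
    rewrite [RHS]big_mkcond; apply: eq_bigr => p _; rewrite /w.
    by case: leqP => _; rewrite ?mul1n ?mul0n // -expnM mulnC.
  rewrite XE (_ : 16 * (q * Y) = Y * (16 * q)) ?(expnM Y); last by lia.
  rewrite leq_exp2r; last by lia.
  apply: (@leq_trans Y`!); last first.
    rewrite fact_prod -[X in _ <= X](_ : \prod_(1 <= i < Y.+1) Y = _).
      by rewrite big_nat [leqRHS]big_nat; apply: leq_prod => i; lia.
    by rewrite prod_nat_const_nat subn1.
  rewrite [leqRHS](prod_primes_logn (fact_gt0 Y)).
  rewrite [X in X <= _](_ : _ = \prod_(p <- [seq p <- l | p \in primes Y`!]) p ^ logn p Y`!).
    rewrite [leqRHS](bigID (mem l)) /= (perm_big [seq p <- primes Y`! | p \in l]) /=.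
      rewrite big_filter leq_pmulr //; elim/big_rec: _ => // p x _ x0.
      rewrite muln_gt0 x0 andbT expn_gt0 lognE; by case: (p).
    apply: uniq_perm; rewrite ?filter_uniq ?primes_uniq // => p.
    by rewrite !mem_filter andbC.
  rewrite big_filter [LHS]big_seq_cond [RHS]big_seq_cond [LHS]big_mkcond [RHS]big_mkcond.
  apply: eq_bigr => p _; case pl: (p \in l) => //=.
  move: pl; rewrite mem_primes => /and3P[p_pr _ _].
  rewrite mem_primes p_pr fact_gt0 /=.
  have dE : (p <= Y) = (p %| Y`!).
    apply/idP/idP => [pY|]; first by rewrite dvdn_fact // prime_gt0.
    rewrite fact_prod Euclid_dvd_prod // big_has_cond => /hasP[j].
    rewrite mem_index_iota => /andP[j0 jY] /dvdn_leq; lia.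
  by rewrite dE.
have MX : M <= X ^ 3 by rewrite ME; nia.
apply: (@leq_trans ((M ^ (5 * q * T) * Y ^ (16 * X)) ^ 2)).
  by rewrite leq_exp2r.
rewrite expnMn -!expnM (_ : 16 * X * 2 = 32 * X) ?leq_mul2r; last by lia.
apply/orP; right.
apply: (@leq_trans ((X ^ 3) ^ (5 * q * T * 2))).
  have [->|T0] := posnP T; first by rewrite muln0.
  by rewrite leq_exp2r // !muln_gt0 T0 q0.
(* The exponent of X is 3 * 5 q T * 2 = 30 q T <= q Y = X. *)
rewrite -expnM leq_pexp2l // XE; have := leq_mul (leqnn q) small; lia.
Qed.

(** For X = Y^33 the factor Y^(32 X) is at most X^X, so too few primes would bound the square of the
    product by (X^X)^2, against [sq1prod_gt_expn]. *)
Lemma size_primes_sq1prod Y : 1 < Y ->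
  Y < 30 * size (primes (sq1prod (Y ^ 33))).
Proof.
move=> Y1; rewrite ltnNge; apply/negP.
have q0 : 0 < Y ^ 32 by rewrite expn_gt0 (ltnW Y1).
have XY : Y ^ 33 = Y ^ 32 * Y by rewrite -expnSr.
have XX m : Y ^ (33 * m) = (Y ^ 33) ^ m by rewrite expnM.
move: (Y ^ 33) (Y ^ 32) q0 XY XX => X q q0 XE XX /(sq1prod_leq Y1 q0 XE).
have X0 : 0 < X by rewrite XE muln_gt0 q0 (ltnW Y1).
apply/negP; rewrite -ltnNge; apply: leq_ltn_trans (_ : (X ^ X) ^ 2 < _); last first.
  by rewrite ltn_exp2r // sq1prod_gt_expn.
by rewrite -mulnn leq_mul2l -XX leq_pexp2l ?(ltnW Y1) ?orbT // leq_mul2r orbT.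
Qed.

(** * Roots of -1 modulo products of primes, and points on circles *)

Definition splitting_prime p := [/\ prime p, odd p & exists m, p %| m ^ 2 + 1].

Lemma many_splitting_primes T : exists l : seq nat,
  [/\ uniq l, size l = T & forall p, p \in l ->
    splitting_prime p /\ p <= (30 * T.+1) ^ 67].
Proof.
have Y1 : 1 < 30 * T.+1 by lia.
have := size_primes_sq1prod Y1.
have Y0 := ltnW Y1.
have bnd : ((30 * T.+1) ^ 33) ^ 2 + 1 <= (30 * T.+1) ^ 67.
  rewrite -expnM (_ : 67 = (33 * 2).+1) // expnS.
  have : 0 < (30 * T.+1) ^ (33 * 2) by rewrite expn_gt0 Y0.
  by move: (_ ^ (33 * 2)) => z; nia.
move: (_ ^ 33) (_ ^ 67) bnd => X B bnd; set l := primes _.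
rewrite ltn_pmul2l // => lT.
pose l' := [seq p <- l | p != 2].
have lT' : T <= size l'.
  rewrite size_filter (_ : count _ l = count (predC (pred1 2)) l) //.
  have := count_predC (pred1 2) l.
  rewrite count_uniq_mem ?primes_uniq // => E.
  by move: lT E; move: (count _ _) (size _) => c z; case: (2 \in l) => /=; lia.
exists (take T l'); split; first by rewrite take_uniq // filter_uniq // primes_uniq.
  by rewrite size_takel.
move=> p /mem_take; rewrite mem_filter mem_primes => /and4P[p2 p_pr _ pX].
have [m mX pm] := dvdn_sq1prod p_pr pX.
split; first split=> //.
- by case: (even_prime p_pr) p2 => // ->.
- by exists m.
apply: (@leq_trans (m ^ 2 + 1)); first by apply: dvdn_leq pm; lia.
by apply: leq_trans bnd; rewrite leq_add2r leq_exp2r.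
Qed.

Lemma splitting_prod_gt0 l : (forall p, p \in l -> splitting_prime p) ->
  0 < \prod_(p <- l) p.
Proof.
move=> Sl; rewrite big_seq; elim/big_rec: _ => // i x /Sl[p_pr _ _] x0.
by rewrite muln_gt0 prime_gt0.
Qed.

Lemma splitting_coprime p l : uniq (p :: l) ->
  (forall q, q \in p :: l -> splitting_prime q) -> coprime p (\prod_(q <- l) q).
Proof.
move=> /= /andP[pl Ul] Sl.
have [p_pr _ _] := Sl p (mem_head _ _).
rewrite prime_coprime // Euclid_dvd_prod // big_has_cond; apply/hasPn => q ql /=.
have [|q_pr _ _] := Sl q; first by rewrite inE ql orbT.
by rewrite dvdn_prime2 //; apply: contraNneq pl => ->.
Qed.

(** Each new prime p doubles the number of roots: by the Chinese remainder theorem an old root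
    combines with either of the two roots m and -m modulo p. *)
Lemma sqrt_neg1_mod_prod l : uniq l -> (forall p, p \in l -> splitting_prime p) ->
  exists s : seq nat, [/\ uniq s, size s = 2 ^ size l &
    forall x, x \in s -> x < \prod_(p <- l) p /\ \prod_(p <- l) p %| x ^ 2 + 1].
Proof.
elim: l => [_ _|p l IH pUl pSl].
  exists [:: 0]; split => // x; rewrite inE => /eqP ->; rewrite big_nil.
  by rewrite dvd1n.
have Ul : uniq l by case/andP: pUl.
have Sl q : q \in l -> splitting_prime q by move=> ql; apply: pSl; rewrite inE ql orbT.
have [s [Us szs sP]] := IH Ul Sl.
have co := splitting_coprime pUl pSl.
have N0 := splitting_prod_gt0 Sl.
have [p_pr p_odd [m pm]] := pSl p (mem_head _ _).
rewrite big_cons; set N := \prod_(q <- l) q in co N0 sP *.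
have p0 := prime_gt0 p_pr.
(* The natural number [p * m - m] represents -m modulo p. *)
have pm' : p %| (p * m - m) ^ 2 + 1.
  have -> : (p * m - m) ^ 2 + 1 = p * (p * m ^ 2 - 2 * m ^ 2) + (m ^ 2 + 1).
    have : 2 < p by rewrite odd_prime_gt2.
    by nia.
  by rewrite dvdn_add // dvdn_mulr.
pose f x (b : bool) := chinese p N (if b then m else p * m - m) x %% (p * N).
have fN x b : f x b = x %[mod N].
  by rewrite /f modn_dvdm ?dvdn_mull // chinese_modr.
have fp x b : f x b = (if b then m else p * m - m) %[mod p].
  by rewrite /f modn_dvdm ?dvdn_mulr // chinese_modl.
(* Otherwise p divides 2 m, hence m because p is odd, hence 1. *)
have neq : m != p * m - m %[mod p].
  apply/negP => h.
  have : m + m == (p * m - m) + m %[mod p] by rewrite -modnDml (eqP h) modnDml.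
  rewrite subnK ?leq_pmull // modnMr -/(dvdn p _) addnn -muln2 Euclid_dvdM //.
  case/orP => [pm2|]; last first.
    by rewrite dvdn_prime2 // => /eqP p2; rewrite p2 in p_odd.
  have := pm; rewrite dvdn_addr ?Euclid_dvdX ?pm2 // dvdn1 => /eqP p1.
  by rewrite p1 in p_pr.
exists [seq f x b | x <- s, b <- [:: true; false]]; split.
- apply: allpairs_uniq => // -[x b] [x' b'] /allpairsP[[x1 b1] [x1s _ [-> ->]]].
  move=> /allpairsP[[x2 b2] [x2s _ [-> ->]]] /= E.
  rewrite /= in x1s x2s.
  have <- : x1 = x2.
    have := fN x1 b1; rewrite E fN !modn_small //.
      by have [] := sP _ x1s.
    by have [] := sP _ x2s.
  congr pair; have := fp x1 b1; rewrite E fp.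
  case: (b1) (b2) => -[] // /eqP h; first by rewrite eq_sym (negPf neq) in h.
  by rewrite (negPf neq) in h.
- by rewrite size_allpairs szs /= expnSr.
- move=> y /allpairsP[[x b] [/= xs _ ->]]; have [xN xd] := sP _ xs.
  split; first by rewrite ltn_mod muln_gt0 p0.
  rewrite Gauss_dvd //; apply/andP; split.
    rewrite /dvdn -modnDml -modnXm fp modnXm modnDml -/(dvdn _ _).
    by case: b.
  by rewrite /dvdn -modnDml -modnXm fN modnXm modnDml.
Qed.

(** With k the integer part of the root of n, there are (k + 1)^2 > n pairs (x, y), so two of them
    agree in x - s y modulo n. Their difference (a, b) has a^2 + b^2 divisible by n and strictly
    between 0 and 2 n; the upper bound is strict as n is not a square. *)
Lemma thue n s : 1 < n -> (forall k, k ^ 2 != n) -> n %| s ^ 2 + 1 ->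
  exists ab : int * int, ((ab.1 ^+ 2 + ab.2 ^+ 2 == n%:Z) &&
                          (n%:Z %| (ab.1 - s%:Z * ab.2)%R)%Z)%R.
Proof.
move=> n1 nsq ns.
have [k [kn nk]] : exists k, k ^ 2 <= n /\ n < k.+1 ^ 2.
  have ub i : i ^ 2 <= n -> i <= n by nia.
  have [i iP max] := ex_maxnP (ex_intro (fun i => i ^ 2 <= n) 0 (leq0n n)) ub.
  by exists i; split => //; rewrite ltnNge; apply/negP => /max; rewrite ltnn.
have {}kn : k ^ 2 < n by rewrite ltn_neqAle nsq.
(* The natural number [n - s %% n] stands for -s modulo n. *)
pose f (xy : 'I_k.+1 * 'I_k.+1) : 'I_n :=
  Ordinal (ltn_pmod (xy.1 + (n - s %% n) * xy.2) (ltnW n1)).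
have : ~~ injectiveb f.
  by apply/negP => /injectiveP /leq_card; rewrite card_prod !card_ord mulnn leqNgt nk.
case/injectivePn => -[x1 y1] [[x2 y2] neq /(congr1 val) /= E].
pose a : int := (x1%:Z - x2%:Z)%R; pose b : int := (y1%:Z - y2%:Z)%R.
exists (a, b) => /=.
have dv : (n%:Z %| (a - s%:Z * b)%R)%Z.
  have : (n%:Z %| ((x1 + (n - s %% n) * y1)%N%:Z - (x2 + (n - s %% n) * y2)%N%:Z)%R)%Z.
    by rewrite -eqz_mod_dvd !modz_nat E.
  rewrite !PoszD !PoszM -subzn; last by rewrite ltnW // ltn_mod ltnW.
  have -> : (x1%:Z + (n%:Z - (s %% n)%N%:Z) * y1%:Z -
     (x2%:Z + (n%:Z - (s %% n)%N%:Z) * y2%:Z) =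
     (a - s%:Z * b) + n%:Z * (b * (1 + (s %/ n)%N%:Z)))%R.
    have := congr1 Posz (divn_eq s n); rewrite PoszD PoszM => ->; rewrite /a /b; ring.
  by rewrite rpredDr // dvdz_mulr.
rewrite dv andbT.
have dv2 : (n%:Z %| (a ^+ 2 + b ^+ 2)%R)%Z.
  have -> : (a ^+ 2 + b ^+ 2 = (a - s%:Z * b) * (a + s%:Z * b) + (s%:Z ^+ 2 + 1) * b ^+ 2)%R by ring.
  by rewrite rpredD // dvdz_mulr.
have pos : (0 < a ^+ 2 + b ^+ 2)%R.
  rewrite lt_neqAle addr_ge0 ?sqr_ge0 // andbT eq_sym paddr_eq0 ?sqr_ge0 //.
  rewrite !sqrf_eq0 !subr_eq0; apply: contra neq => /andP[/eqP[e1] /eqP[e2]].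
  by rewrite xpair_eqE; apply/andP; split; apply/eqP/val_inj.
have sq (x y : 'I_k.+1) : ((x%:Z - y%:Z) ^+ 2 <= Posz (k ^ 2))%R.
  have /andP[h1 h2] : ((0 <= k%:Z - (x%:Z - y%:Z)) && (0 <= k%:Z + (x%:Z - y%:Z)))%R.
    by move: (nat_of_ord x) (nat_of_ord y) (ltn_ord x) (ltn_ord y) => u v; clear; lia.
  have := mulr_ge0 h1 h2; rewrite -subr_sqr subr_ge0.
  by rewrite -[Posz (k ^ 2)]natz natrX natz.
have sm : (a ^+ 2 + b ^+ 2 < 2 * n%:Z)%R.
  have := sq x1 x2; have := sq y1 y2; rewrite -/a -/b; move: (a ^+ 2)%R (b ^+ 2)%R (k ^ 2) kn => u v w; clear; lia.
case/dvdzP: dv2 => c E2; rewrite E2 in pos sm *.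
have n0 : (0 < n%:Z)%R by rewrite ltz_nat ltnW.
rewrite pmulr_lgt0 // in pos; rewrite ltr_pM2r // in sm; clear -pos sm.
by have -> : c = 1%R by [lia]; rewrite mul1r.
Qed.

(* A root [s] of [-1] modulo the squarefree number [n] is recovered from the
   point [(a, b)] of Thue's lemma as [a / b] modulo [n]. *)
Lemma many_circle_points T : 0 < T -> exists n (s : seq (int * int)),
  [/\ n <= (30 * T.+1) ^ (67 * T), uniq s, size s = 2 ^ T &
    forall ab, ab \in s -> (ab.1 ^+ 2 + ab.2 ^+ 2 = n%:Z)%R].
Proof.
move=> T0; have [l [Ul szl lP]] := many_splitting_primes T.
have Sl p : p \in l -> splitting_prime p by move=> /lP[].
have [s [Us szs sP]] := sqrt_neg1_mod_prod Ul Sl.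
have n0 := splitting_prod_gt0 Sl.
(* The product is squarefree. This shows that it is not a square, as Thue's lemma requires, and
   later that b is invertible modulo it. *)
have sqf p : p \in l -> logn p (\prod_(q <- l) q) = 1.
  move=> pl; have [p_pr _ _] := Sl p pl.
  rewrite (perm_big _ (perm_to_rem pl)) big_cons lognM //; last 2 first.
  - exact: prime_gt0.
  - by apply: splitting_prod_gt0 => q /mem_rem /Sl.
  rewrite logn_prime // eqxx (_ : logn p _ = 0) //.
  apply/eqP; rewrite -leqn0 -ltnS -(leq_add2l 0) add0n.
  have co : coprime p (\prod_(q <- rem p l) q).
    apply: splitting_coprime; rewrite /= ?mem_rem_uniqF ?rem_uniq // => q.
    by rewrite inE => /predU1P[->|/mem_rem]; exact: Sl.
  by rewrite logn_coprime.
have nE p : prime p -> p %| \prod_(q <- l) q -> p \in l.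
  move=> p_pr; rewrite Euclid_dvd_prod // big_has_cond => /hasP[q ql /=].
  by have [q_pr _ _] := Sl q ql; rewrite dvdn_prime2 // => /eqP ->.
have [p0 p0l] : exists p, p \in l.
  by case: (l) szl T0 => [<-//|p ? _ _]; exists p; rewrite mem_head.
have n1 : 1 < \prod_(q <- l) q.
  rewrite ltn_neqAle n0 andbT eq_sym; apply/eqP => E.
  by have := sqf _ p0l; rewrite E logn1.
have nB : \prod_(q <- l) q <= (30 * T.+1) ^ (67 * T).
  rewrite expnM; set B := _ ^ 67 in lP *; have B0 : 0 < B by rewrite expn_gt0.
  rewrite -szl; apply: leq_trans (prod_expn_const l predT B0).
  by rewrite big_seq [leqRHS]big_seq; apply: leq_prod => q /lP[].
set n := \prod_(q <- l) q in sP n0 sqf nE n1 nB.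
have nsq k : k ^ 2 != n.
  apply/eqP => E; have /(congr1 odd) := sqf _ p0l.
  by rewrite -E lognX oddM.
(* The membership test is placed under the existential so that [xchoose] yields a function of all
   x. *)
have th x : exists ab : int * int, (x \in s) ==>
    ((ab.1 ^+ 2 + ab.2 ^+ 2 == n%:Z) && (n%:Z %| (ab.1 - x%:Z * ab.2)%R)%Z)%R.
  case xs: (x \in s) => /=; last by exists (0, 0)%R.
  by apply: thue => //; have [] := sP x xs.
pose f x := xchoose (th x).
have fP x : x \in s -> ((f x).1 ^+ 2 + (f x).2 ^+ 2 = n%:Z)%R /\
    (n%:Z %| ((f x).1 - x%:Z * (f x).2)%R)%Z.
  by move=> xs; have /implyP/(_ xs)/andP[/eqP] := xchooseP (th x).
exists n, [seq f x | x <- s]; split => //.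
- rewrite map_inj_in_uniq // => x y xs ys fxy.
  have [f1 f2] := fP x xs; have [_ f3] := fP y ys.
  rewrite -fxy in f3; move: f1 f2 f3; move: (f x) => [a b] /= ab xa ya.
  (* A common prime of n and b would also divide a, so its square would divide a^2 + b^2 = n. *)
  have co : coprimez n b.
    rewrite /coprimez /gcdz absz_nat -/(coprime n `|b|); apply/negPn/negP => nco.
    have [p p_pr pd] : exists2 p, prime p & p %| gcdn n `|b|.
      exists (pdiv (gcdn n `|b|)); last exact: pdiv_dvd.
      by rewrite pdiv_prime // ltn_neqAle eq_sym nco gcdn_gt0 n0.
    rewrite dvdn_gcd in pd; case/andP: pd => pn pb.
    have pbz : (p%:Z %| b)%Z by rewrite dvdzE.
    have paz : (p%:Z %| a)%Z.
      rewrite -(subrK (x%:Z * b)%R a) rpredD ?dvdz_mull //.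
      by apply: dvdz_trans xa; rewrite dvdzE.
    have : p ^ 2 %| n.
      case/dvdzP: pbz ab => u ->; case/dvdzP: paz => v -> E.
      rewrite -[n]/(absz (Posz n)) -E (_ : _ + _ = (u ^+ 2 + v ^+ 2) * p%:Z ^+ 2)%R; last by ring.
      by rewrite abszM abszX absz_nat dvdn_mull.
    by rewrite pfactor_dvdn // sqf ?nE.
  have : (n%:Z %| ((x%:Z - y%:Z) * b)%R)%Z.
    have -> : ((x%:Z - y%:Z) * b = (a - y%:Z * b) - (a - x%:Z * b))%R by ring.
    by rewrite rpredB.
  rewrite Gauss_dvdzl // -eqz_mod_dvd !modz_nat => /eqP[].
  have [xn _] := sP x xs; have [yn _] := sP y ys.
  by rewrite !modn_small.
- by rewrite size_map szs szl.
- by move=> ab /mapP[x /fP[h _] ->].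
Qed.

Local Open Scope classical_set_scope.
Local Open Scope ring_scope.

(** * Integration over the torus cell *)

Section cell.
Variable R : realType.
Local Notation tup n := (n.-tuple (measurableTypeR R)).
Local Notation mu n := (lebesgue_tuple R n).

Definition tuple_cell n : set (tup n) := [set t | forall i, 0 <= tnth t i < 2 * pi].

Lemma tcons_cell n :
  @tcons _ (measurableTypeR R) n @^-1` (@tuple_cell n.+1) = `[0, 2 * pi[ `*` @tuple_cell n.
Proof.
apply/seteqP; split=> -[x t] /=.
  move=> H; split => [|i]; first by have := H ord0; rewrite tnth0 in_itv.
  by have := H (lift ord0 i); rewrite tnthS.
case=> /= x0 H i; case: (unliftP ord0 i) => [j ->|->].
  by rewrite tnthS; exact: H.
by rewrite tnth0; rewrite in_itv in x0.
Qed.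

Lemma measurable_tuple_cell n : measurable (@tuple_cell n).
Proof.
have -> : @tuple_cell n =
    \bigcap_(i in [set: 'I_n]) ((fun t : tup n => tnth t i) @^-1` `[0, 2 * pi[).
  by apply/seteqP; split=> t /= H i; have := H i; rewrite /= in_itv //= => /(_ I).
apply: fin_bigcap_measurable => // i _.
rewrite -[X in measurable X]setTI; apply: measurable_tnth => //.
Qed.

Lemma lebesgue_measure_period :
  lebesgue_measure (`[0, 2 * pi[%classic : set R) = (2 * pi)%:E.
Proof.
by rewrite lebesgue_measure_itv /= lte_fin mulr_gt0 ?pi_gt0 // -EFinD subr0.
Qed.

Lemma mu_tuple_cell n : mu n (@tuple_cell n) = ((2 * pi) ^+ n)%:E.
Proof.
elim: n => [|n IH].
  by rewrite /lebesgue_tuple /= diracE mem_set //= => -[].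
rewrite /lebesgue_tuple /= /tcons_measure /pushforward tcons_cell.
rewrite product_measure1E //; last exact: measurable_tuple_cell.
apply: (etrans (congr2 mule lebesgue_measure_period IH)).
by rewrite -EFinM exprS.
Qed.

(** Fubini's theorem for the first coordinate; a bounded function is integrable because the cell has
    finite measure. *)
Lemma integral_lebesgue_tupleS n (f : tup n.+1 -> R) :
  measurable_fun setT f -> (exists M, forall t, `|f t| <= M) ->
  (\int[mu n.+1]_(t in @tuple_cell n.+1) (f t)%:E =
   \int[@lebesgue_measure R]_(x in `[0%R, (2 * pi)%R[)
     \int[mu n]_(t in @tuple_cell n) (f (tcons (x, t)))%:E)%E.
Proof.
move=> mf [M fM].
have mc := @measurable_tuple_cell n.
have mtc : measurable_fun [set: measurableTypeR R * tup n] (@tcons _ (measurableTypeR R) n).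
  exact: measurable_tcons.
have mI : measurable (`[0, 2 * pi[%classic : set (measurableTypeR R)) by exact: measurable_itv.
have mD : measurable ((`[0, 2 * pi[%classic : set (measurableTypeR R)) `*` @tuple_cell n).
  exact: measurableX.
have iD : ((@lebesgue_measure R) \x (mu n))%E.-integrable
    ((`[0, 2 * pi[%classic : set (measurableTypeR R)) `*` @tuple_cell n)
    (EFin \o (f \o @tcons _ (measurableTypeR R) n)).
  apply: measurable_bounded_integrable => //.
  - have PE := product_measure1E (@lebesgue_measure R) (mu n) mI mc.
    have := etrans PE (congr2 mule lebesgue_measure_period (mu_tuple_cell n)).
    by rewrite -EFinM => E; apply: (eq_ind_r (fun z => z < +oo)%E _ E); rewrite ltry.
  - apply: measurable_funTS; exact: measurableT_comp.
  - exists M; split; first exact: num_real.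
    by move=> y My p _ /=; apply: (le_trans (fM _)); exact: ltW.
transitivity (\int[(@lebesgue_measure R) \x (mu n)]_(p in `[0%R, (2 * pi)%R[ `*` @tuple_cell n)
   (f (@tcons _ (measurableTypeR R) n p))%:E)%E.
  rewrite -tcons_cell.
  rewrite -[RHS](@integral_pushforward _ _ _ _ _ _ mtc _ (@tuple_cell n.+1) (EFin \o f)) //.
  - exact/measurable_EFinP.
  - exact: (eq_ind_r (fun D => (lebesgue_measure \x mu n)%E.-integrable D
      (EFin \o (f \o @tcons _ (measurableTypeR R) n))) iD (@tcons_cell n)).
  - exact: measurable_tuple_cell.
rewrite integral_mkcond.
rewrite -integral12_prod_meas1; last exact/(integrable_mkcond _ mD).
rewrite [RHS]integral_mkcond.
apply: eq_integral => x _; rewrite /fubini_F /patch.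
have [xI|xI] := boolP (x \in `[0, 2 * pi[%classic).
  rewrite [RHS]integral_mkcond; apply: eq_integral => t _; rewrite /patch.
  by rewrite in_setX xI.
by rewrite integral0_eq // => t _; rewrite /patch in_setX (negPf xI).
Qed.

End cell.

(** * Integrals of cosines over full periods *)

Section cos_periods.
Variable R : realType.
Local Notation tup n := (n.-tuple (measurableTypeR R)).
Local Notation mu n := (lebesgue_tuple R n).

Lemma cosD_int_period (x : R) (k : int) : cos (x + k%:~R * (2 * pi)) = cos x.
Proof.
have per n y : cos (y + n%:R * (2 * pi)) = cos y :> R.
  rewrite (_ : n%:R * (2 * pi) = (pi *+ 2) *+ n); last by rewrite -[RHS]mulr_natl -[pi *+ 2]mulr_natl.
  exact: (periodicn (@cosD2pi R)).
case: k => n; first exact: per.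
by rewrite NegzE mulrNz mulNr -(per n.+1 (_ - _)) subrK.
Qed.

Lemma is_derive_cos_affine (k b x : R) :
  is_derive x 1 (fun h => cos (k * h + b)) (k * cos (k * x + b + pi / 2)).
Proof.
have dA : is_derive x 1 (fun h => k * h + b) k.
  have dZ := @is_deriveZ _ _ _ (id : R -> R) k x 1 1 (is_derive_id _ _).
  have := @is_deriveD _ _ _ _ (cst b) x 1 _ 0 dZ (is_derive_cst _ _ _).
  by rewrite addr0 /GRing.scale /= mulr1.
have := @is_derive1_comp _ (@cos R) (fun h => k * h + b) x _ _ (is_derive_cos _) dA.
by rewrite cosDpihalf mulrC.
Qed.

Lemma continuous_cos_affine (k b : R) : continuous (fun h => cos (k * h + b)).
Proof.
move=> x; apply: differentiable_continuous; apply/derivable1_diffP.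
by have [] := is_derive_cos_affine k b x.
Qed.

Lemma integral_cos_period (k : int) (b : R) :
  (\int[@lebesgue_measure R]_(x in `[0%R, (2 * pi)%R[) (cos (k%:~R * x + b))%:E =
   ((if k == 0 then 2 * pi else 0) * cos b)%:E)%E.
Proof.
have pi0 : 0 < 2 * pi :> R by rewrite mulr_gt0 ?pi_gt0.
case: eqVneq => [->|k0].
  under eq_integral do rewrite mul0r add0r.
  rewrite integral_cst /=; last exact: measurable_itv.
  by rewrite lebesgue_measure_period -EFinM mulrC.
have kR0 : k%:~R != 0 :> R by rewrite intr_eq0.
rewrite integral_itv_bndo_bndc; last first.
  apply/measurable_EFinP/measurable_funTS; apply: continuous_measurable_fun.
  exact: continuous_cos_affine.
(* Differentiation shifts the phase by pi / 2, so the antiderivative shifts it back; F agrees at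
   both ends because k is an integer. *)
pose F x : R := k%:~R^-1 * cos (k%:~R * x + (b - pi / 2)).
have dF (x : R) : is_derive x 1 F (cos (k%:~R * x + b)).
  have := @is_deriveZ _ _ _ _ k%:~R^-1 x 1 _ (is_derive_cos_affine k%:~R (b - pi / 2) x).
  by rewrite /GRing.scale /= mulrA mulVf // mul1r addrA subrK.
have cF : continuous F.
  move=> x; apply: differentiable_continuous; apply/derivable1_diffP.
  by have [] := dF x.
rewrite (@continuous_FTC2 _ _ F) //.
- rewrite -EFinB /F mulr0 add0r (addrC (_ * (2 * pi))) cosD_int_period subrr.
  by rewrite mul0r.
- by apply: continuous_subspaceT => x; exact: continuous_cos_affine.
- split=> [x _| |]; first by have [] := dF x.
  + by apply: cvg_at_right_filter; exact: cF.
  + by apply: cvg_at_left_filter; exact: cF.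
- by move=> x _; rewrite derive1E; have [_ ->] := dF x.
Qed.

Definition phase n (z : 'I_n -> int) (b : R) (t : tup n) : R :=
  \sum_(i < n) (z i)%:~R * tnth t i + b.

Lemma measurable_phase n (z : 'I_n -> int) b : measurable_fun setT (phase z b).
Proof.
apply: measurable_funD; last exact: measurable_cst.
apply: measurable_sum => i.
by apply: measurable_funM => //; exact: measurable_tnth.
Qed.

Lemma measurable_cos_phase n (z : 'I_n -> int) b :
  measurable_fun setT (fun t => cos (phase z b t)).
Proof.
apply: measurableT_comp (measurable_phase z b).
apply: continuous_measurable_fun; exact: continuous_cos.
Qed.

(** Induction on the dimension: the first coordinate is absorbed into the shift b, which therefore
    has to be arbitrary. *)
Lemma integral_cos_cell n (z : 'I_n -> int) b :
  (\int[mu n]_(t in @tuple_cell R n) (cos (phase z b t))%:E =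
   (\prod_(i < n) (if z i == 0 then 2 * pi else 0) * cos b)%:E)%E.
Proof.
elim: n z b => [|n IH] z b.
  rewrite big_ord0 mul1r.
  rewrite integral_dirac; last 2 first.
  - exact: measurable_tuple_cell.
  - by apply/measurable_EFinP/measurable_funTS; exact: measurable_cos_phase.
  rewrite diracE mem_set ?mul1e; last by case.
  by rewrite /phase big_ord0 add0r.
rewrite integral_lebesgue_tupleS; last 2 first.
- exact: measurable_cos_phase.
- by exists 1 => t; exact: cos_max.
rewrite big_ord_recl.
transitivity (\int[@lebesgue_measure R]_(x in `[0%R, (2 * pi)%R[)
  ((\prod_(i < n) (if z (lift ord0 i) == 0 then 2 * pi else 0))%:E *
    (cos ((z ord0)%:~R * x + b))%:E))%E.
  apply: eq_integral => x _; rewrite -EFinM -(IH (fun i => z (lift ord0 i))).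
  apply: eq_integral => t _; congr (cos _)%:E.
  rewrite /phase big_ord_recl /tcons tnth0 -addrA addrCA; congr (_ + _).
  by apply: eq_bigr => i _; rewrite tnthS.
rewrite integralZl //; last first.
  apply: measurable_bounded_integrable.
  - exact: measurable_itv.
  - have E := @lebesgue_measure_period R.
    by apply: (eq_ind_r (fun z => z < +oo)%E _ E); rewrite ltry.
  - apply/measurable_funTS; apply: continuous_measurable_fun.
    exact: continuous_cos_affine.
  - exists 1; split; first exact: num_real.
    by move=> M M1 p _ /=; apply: (le_trans (cos_max _)); exact: ltW.
by rewrite integral_cos_period -EFinM mulrA [(\prod_(_ < n) _) * _]mulrC.
Qed.

End cos_periods.

(** * Trigonometric polynomials *)

Section trig.
Local Open Scope complex_scope.
Variable R : realType.

Definition dotp d (k : 'rV[int]_d) (x : 'rV[R]_d) : R :=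
  \sum_(i < d) (k 0 i)%:~R * x 0 i.

Lemma dotpDr d (k : 'rV[int]_d) (x y : 'rV[R]_d) : dotp k (x + y) = dotp k x + dotp k y.
Proof. by rewrite /dotp -big_split; apply: eq_bigr => i _; rewrite mxE mulrDr. Qed.

Lemma dotpBl d (k l : 'rV[int]_d) (x : 'rV[R]_d) : dotp (k - l) x = dotp k x - dotp l x.
Proof.
by rewrite /dotp -sumrB; apply: eq_bigr => i _; rewrite !mxE intrB mulrBl.
Qed.

Lemma dotpZ_delta d (k : 'rV[int]_d) (h : R) i : dotp k (h *: delta_mx 0 i) = (k 0 i)%:~R * h.
Proof.
rewrite /dotp (bigD1 i) //= big1 => [|j ji]; first by rewrite !mxE !eqxx mulr1 addr0.
by rewrite !mxE (negPf ji) !mulr0.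
Qed.

Lemma dotp_period d (k l : 'rV[int]_d) :
  dotp k ((2 * pi) *: map_mx intr l) = (\sum_(i < d) k 0 i * l 0 i)%:~R * (2 * pi).
Proof.
rewrite /dotp rmorph_sum mulr_suml; apply: eq_bigr => i _.
by rewrite !mxE rmorphM /= (mulrC (2 * pi)) mulrA.
Qed.

Lemma continuous_dotp d (k : 'rV[int]_d) : continuous (dotp k).
Proof.
apply: continuous_big => [|i _ x]; first exact: add_continuous.
apply: (@continuous_comp _ _ _ (fun x : 'rV[R]_d => x 0 i) ( *%R (k 0 i)%:~R)).
  exact: coord_continuous.
exact: mulrl_continuous.
Qed.

Variables (d N : nat) (xi : 'I_N -> 'rV[int]_d).
Implicit Types (a : 'I_N -> R) (b c : R).

(** A phase shift replaces sines: a partial derivative multiplies the coefficients by integers and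
    adds pi / 2 to b, so the family is closed under differentiation. *)
Definition trig a b (x : 'rV[R]_d) : R := \sum_(j < N) a j * cos (dotp (xi j) x + b).

Lemma continuous_trig a b : continuous (trig a b).
Proof.
apply: continuous_big => [|j _ x]; first exact: add_continuous.
apply: (@continuous_comp _ _ _ (dotp (xi j)) (fun t => a j * cos (t + b))).
  exact: continuous_dotp.
apply: (@continuous_comp _ _ _ (fun t => cos (t + b)) ( *%R (a j))).
  by have := @continuous_cos_affine R 1 b; under eq_fun do rewrite mul1r; apply.
exact: mulrl_continuous.
Qed.

Lemma is_derive_trig a b x i :
  is_derive x (delta_mx 0 i) (trig a b)
    (trig (fun j => a j * (xi j 0 i)%:~R) (b + pi / 2) x).
Proof.
set df := trig _ _ x.
have D1 : is_derive (0 : R) (1 : R) (fun h : R => trig a b (h *: delta_mx 0 i + x)) df.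
  have -> : (fun h : R => trig a b (h *: delta_mx 0 i + x)) =
     \sum_(j < N) (fun h : R => a j * cos ((xi j 0 i)%:~R * h + (dotp (xi j) x + b))).
    apply/funext => h; rewrite /trig fct_sumE; apply: eq_bigr => j _.
    by rewrite dotpDr dotpZ_delta addrA.
  rewrite /df /trig; apply: is_derive_sum => j.
  have D := @is_deriveZ _ _ _ _ (a j) (0 : R) 1 _
    (is_derive_cos_affine (xi j 0 i)%:~R (dotp (xi j) x + b) 0).
  by rewrite mulr0 add0r in D; rewrite -mulrA addrA; exact: D.
case: D1 => D1 D2.
have dv : derivable (trig a b) x (delta_mx 0 i) by apply/derivable1P.
apply: DeriveDef => //.
rewrite -D2 /derive; set g1 := fun h => h^-1 *: _; set g2 := fun h => h^-1 *: _.
suff -> : g1 = g2 by [].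
by rewrite /g1 /g2; apply/funext => h /=; rewrite addr0 scale0r add0r [_%:A]mulr1.
Qed.

(** For c = b - pi / 2 this is the sum of the a_j exp(i (xi_j . x + b)). *)
Definition wave a b c (x : 'rV[R]_d) : R[i] := trig a b x +i* trig a c x.

Lemma partial_wave a b c i :
  partial i (wave a b c) =
  wave (fun j => a j * (xi j 0 i)%:~R) (b + pi / 2) (c + pi / 2).
Proof.
apply/funext => x; rewrite /partial /wave /=.
by have [_ ->] := is_derive_trig a b x i; have [_ ->] := is_derive_trig a c x i.
Qed.

Lemma partials_wave a b c s : exists a' b' c', partials s (wave a b c) = wave a' b' c'.
Proof.
elim: s => [|i s [a' [b' [c' E]]]] /=; first by exists a, b, c.
rewrite -/(partials s _) E partial_wave.
by do 3 eexists.
Qed.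

Lemma smooth_wave a b c : smooth (wave a b c).
Proof.
move=> s; have [a' [b' [c' ->]]] := partials_wave a b c s; split.
- exact: continuous_trig.
- exact: continuous_trig.
- move=> i x; split.
    by have [] := is_derive_trig a' b' x i.
  by have [] := is_derive_trig a' c' x i.
Qed.

Lemma periodic_wave a b c : Defs.periodic (wave a b c).
Proof.
move=> x k; rewrite /wave /trig.
by congr (_ +i* _); apply: eq_bigr => j _;
  rewrite dotpDr dotp_period addrAC cosD_int_period.
Qed.

Lemma complex_sum n (f g : 'I_n -> R) :
  \sum_(i < n) (f i +i* g i) = (\sum_(i < n) f i) +i* (\sum_(i < n) g i).
Proof. by elim/big_rec3: _ => // i x y z _ ->. Qed.

(** Two shifts by pi / 2 change the sign, and the squared components of each frequency add up to
    q. *)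
Lemma laplacian_trig a b (x : 'rV[R]_d) (q : int) :
  (forall j, \sum_(i < d) (xi j 0 i) ^+ 2 = q) ->
  \sum_(i < d) trig (fun j => a j * (xi j 0 i)%:~R * (xi j 0 i)%:~R) (b + pi / 2 + pi / 2) x =
  - (q%:~R * trig a b x).
Proof.
move=> xiq; rewrite /trig exchange_big mulr_sumr -sumrN; apply: eq_bigr => j _ /=.
rewrite -mulr_suml (_ : \sum_(i < d) _ = a j * q%:~R); last first.
  rewrite -(xiq j) rmorph_sum mulr_sumr; apply: eq_bigr => i _.
  by rewrite rmorphXn expr2 mulrA.
rewrite (_ : dotp (xi j) x + (b + pi / 2 + pi / 2) = dotp (xi j) x + b + pi).
  by rewrite cosDpi mulrN (mulrC (a j)) mulrA.
by rewrite -!addrA -splitr.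
Qed.

Lemma wave_eigen a b c (lam : R) (q : int) : lam ^+ 2 = q%:~R ->
  (forall j, \sum_(i < d) (xi j 0 i) ^+ 2 = q) ->
  @laplace_eigenspace R d lam (wave a b c).
Proof.
move=> lq xiq; split; [exact: periodic_wave|exact: smooth_wave|move=> x].
rewrite /laplacian.
under eq_bigr do rewrite /partials /= !partial_wave.
rewrite /wave complex_sum !(laplacian_trig _ _ _ xiq) lq.
by rewrite /GRing.mul /= /GRing.opp /= !opprK !mul0r subr0 addr0.
Qed.

End trig.

(** * Averages of the squared modulus of a sum of plane waves *)

Section averages.
Local Open Scope complex_scope.
Variables (R : realType) (d N : nat) (xi : 'I_N -> 'rV[int]_d) (a : 'I_N -> R).
Local Notation tup := (d.-tuple (measurableTypeR R)).
Local Notation mu := (lebesgue_tuple R d).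

Definition plane_waves := wave xi a 0 (- (pi / 2)).

(** Only differences of frequencies survive. This gives orthogonality on the torus, and later the
    cancellation of a common first component. *)
Lemma sqmod_plane_waves x : sqmod (plane_waves x) =
  \sum_(j < N) \sum_(l < N) a j * a l * cos (dotp (xi j - xi l) x).
Proof.
rewrite /sqmod /plane_waves /wave /trig /= !expr2 !big_distrlr /= -big_split.
apply: eq_bigr => j _; rewrite -big_split; apply: eq_bigr => l _ /=.
by rewrite !addr0 !cosBpihalf dotpBl cosB mulrDr; congr (_ + _); rewrite mulrACA.
Qed.

Lemma sqmod_plane_waves_tuple (t : tup) : sqmod (plane_waves (row_of_tuple t)) =
  \sum_(j < N) \sum_(l < N) a j * a l * cos (phase (fun i => (xi j - xi l) 0 i) 0 t).
Proof.
rewrite sqmod_plane_waves; apply: eq_bigr => j _; apply: eq_bigr => l _.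
congr (_ * cos _); rewrite /dotp /phase addr0; apply: eq_bigr => i _.
by rewrite [X in _ * X]mxE.
Qed.

Lemma measurable_sqmod_plane_waves :
  measurable_fun setT (fun t : tup => sqmod (plane_waves (row_of_tuple t))).
Proof.
under eq_fun do rewrite sqmod_plane_waves_tuple.
apply: measurable_sum => j; apply: measurable_sum => l.
by apply: measurable_funM; [exact: measurable_cst|exact: measurable_cos_phase].
Qed.

Lemma torus_cell_tuple : @row_of_tuple R d @^-1` @torus_cell R d = @tuple_cell R d.
Proof. by apply/seteqP; split=> t H i; have := H i; rewrite mxE. Qed.

Lemma integrable_cos_phase (z : 'I_d -> int) :
  mu.-integrable (@tuple_cell R d) (fun t => (cos (phase z 0 t))%:E).
Proof.
apply: measurable_bounded_integrable.
- exact: measurable_tuple_cell.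
- by apply: (eq_ind_r (fun z => z < +oo)%E _ (@mu_tuple_cell R d)); rewrite ltry.
- apply/measurable_funTS; exact: measurable_cos_phase.
- exists 1; split; first exact: num_real.
  by move=> M M1 t _ /=; apply: (le_trans (cos_max _)); exact: ltW.
Qed.

(** Parseval's identity: distinct frequencies differ in some component, and the integral over that
    coordinate vanishes. *)
Lemma average_torus_plane_waves : injective xi ->
  average (@torus_cell R d) (@sqmod R \o plane_waves) = \sum_(j < N) a j ^+ 2.
Proof.
move=> xi_inj; rewrite /average torus_cell_tuple mu_tuple_cell /=.
have pi0 : 2 * pi != 0 :> R by rewrite mulf_neq0 // gt_eqF // pi_gt0.
rewrite /Rintegral.
have -> : (\int[mu]_(t in @tuple_cell R d) (sqmod (plane_waves (row_of_tuple t)))%:E =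
   (\sum_(j < N) a j ^+ 2 * (2 * pi) ^+ d)%:E)%E.
  under eq_integral do rewrite sqmod_plane_waves_tuple -sumEFin.
  rewrite integral_sum; last 2 first.
  - exact: measurable_tuple_cell.
  - move=> j; under eq_fun do rewrite -sumEFin.
    apply: integrable_sum; first exact: measurable_tuple_cell.
    move=> l _; under eq_fun do rewrite EFinM.
    by apply: integrableZl; [exact: measurable_tuple_cell|exact: integrable_cos_phase].
  rewrite -sumEFin; apply: eq_bigr => j _.
  under eq_integral do rewrite -sumEFin.
  rewrite integral_sum; last 2 first.
  - exact: measurable_tuple_cell.
  - move=> l; under eq_fun do rewrite EFinM.
    by apply: integrableZl; [exact: measurable_tuple_cell|exact: integrable_cos_phase].
  have I l : (\int[mu]_(t in @tuple_cell R d)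
      (a j * a l * cos (phase (fun i => (xi j - xi l) 0 i) 0 t))%:E =
      (if l == j then a j ^+ 2 * (2 * pi) ^+ d else 0)%:E)%E.
    under eq_integral do rewrite EFinM.
    rewrite integralZl; last 2 first.
    - exact: measurable_tuple_cell.
    - exact: integrable_cos_phase.
    rewrite integral_cos_cell cos0 mulr1 -EFinM; congr _%:E.
    case: eqVneq => [->|lj].
      rewrite subrr (eq_bigr (fun=> 2 * pi)); last by move=> i _; rewrite mxE eqxx.
      by rewrite prodr_const card_ord expr2.
    have [i ne] : exists i, (xi j - xi l) 0 i != 0.
      apply/existsP; apply: contraNT lj => /existsPn H; apply/eqP/xi_inj/esym/eqP.
      rewrite -subr_eq0; apply/eqP/rowP => i; rewrite [RHS]mxE.
      by apply/eqP; move: (H i); rewrite negbK.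
    by rewrite (bigD1 i) //= (negPf ne) mul0r mulr0.
  under eq_bigr do rewrite I.
  rewrite sumEFin (bigD1 j) //= eqxx big1 ?addr0 // => l lj.
  by rewrite (negPf lj).
by rewrite /= -mulr_suml mulrC mulfK // expf_neq0.
Qed.

Lemma measurable_ball_tuple (r : R) :
  measurable (@row_of_tuple R d @^-1` @eball R d r).
Proof.
pose f (t : tup) : R := Num.sqrt (\sum_(i < d) tnth t i ^+ 2).
have -> : @row_of_tuple R d @^-1` @eball R d r = f @^-1` `]-oo, r[.
  have S (t : tup) : \sum_(i < d) row_of_tuple t 0 i ^+ 2 = \sum_(i < d) tnth t i ^+ 2.
    by apply: eq_bigr => i _; rewrite mxE.
  by apply/seteqP; split=> t; rewrite /f /eball /= in_itv /= S.
rewrite -[X in measurable X]setTI.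
have mf : measurable_fun setT f; last by apply: mf => //; exact: measurable_itv.
apply: (@measurableT_comp _ _ _ _ _ _ (@Num.sqrt R)).
  by apply: continuous_measurable_fun; exact: sqrt_continuous.
apply: measurable_sum => i; apply: measurable_funX; exact: measurable_tnth.
Qed.

Lemma average_ball_plane_waves_le (r B : R) : 0 <= B ->
  (forall x, @eball R d r x -> sqmod (plane_waves x) <= B) ->
  average (@eball R d r) (@sqmod R \o plane_waves) <= B.
Proof.
move=> B0 HB; rewrite /average.
set D := _ @^-1` _; have mD : measurable D := measurable_ball_tuple r.
(* An infinite measure has [fine] equal to 0, whose inverse is 0, so the average is 0; measure zero
   is handled alike below. Thus the volume of the ball is never computed. *)
have [muD|muD] := eqVneq (mu D) +oo%E; first by rewrite muD /= invr0 mul0r.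
have fD : mu D \is a fin_num by rewrite ge0_fin_numE ?measure_ge0 // ltey.
have le1 : (\int[mu]_(t in D) ((@sqmod R \o plane_waves) (row_of_tuple t))%:E <= B%:E * mu D)%E.
  rewrite -integral_cst //; apply: ge0_le_integral => //.
  - by move=> t _; rewrite lee_fin addr_ge0 ?sqr_ge0.
  - apply/measurable_EFinP/measurable_funTS; exact: measurable_sqmod_plane_waves.
  - by move=> t Dt; rewrite lee_fin HB.
have le2 : \int[mu]_(t in D) (@sqmod R \o plane_waves) (row_of_tuple t) <= B * fine (mu D).
  rewrite /Rintegral -lee_fin EFinM (fineK fD) fineK //.
  rewrite ge0_fin_numE; last by apply: integral_ge0 => t _; rewrite lee_fin addr_ge0 ?sqr_ge0.
  by apply: (le_lt_trans le1); rewrite -(fineK fD) -EFinM ltry.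
have m0 : 0 <= fine (mu D) by rewrite fine_ge0.
have [->|mne] := eqVneq (fine (mu D)) 0; first by rewrite invr0 mul0r.
by rewrite ler_pdivrMl ?lt_neqAle 1?eq_sym ?mne // mulrC.
Qed.

End averages.

(** * Taylor's formula for the cosine *)

Section taylor.
Variable R : realType.

Lemma is_derive_monomial (c x : R) n :
  is_derive x 1 (fun h => c / n.+1`!%:R * h ^+ n.+1) (c / n`!%:R * x ^+ n).
Proof.
have dX : is_derive x (1 : R) (fun h : R => h ^+ n.+1) (n.+1%:R * x ^+ n).
  have := @is_deriveX _ _ (id : R -> R) n.+1 x 1 1 (is_derive_id _ _).
  by rewrite /GRing.scale /= mulr1 fctE.
have := @is_deriveZ _ _ _ _ (c / n.+1`!%:R) x 1 _ dX.
rewrite /GRing.scale /=.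
rewrite (_ : c / n.+1`!%:R * (n.+1%:R * x ^+ n) = c / n`!%:R * x ^+ n) //.
rewrite factS natrM; field.
by rewrite pnatr_eq0 -lt0n fact_gt0 nat1r pnatr_eq0.
Qed.

(** After reflection to x >= 0, the mean value theorem applies to y^(k+1) / (k+1)! - s f(y), whose
    derivative is nonnegative on the positive axis, for s = 1 and s = -1. *)
Lemma ler_norm_derive_monomial (f df : R -> R) k :
  (forall x : R, is_derive x 1 f (df x)) -> f 0 = 0 ->
  (forall x, `|df x| <= `|x| ^+ k / k`!%:R) ->
  forall x, `|f x| <= `|x| ^+ k.+1 / k.+1`!%:R.
Proof.
move=> + + + x; wlog x0 : f df x / 0 <= x => [hw dF f0 bnd|].
  have [x0|/ltW x0] := leP 0 x; first exact: hw dF f0 bnd.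
  have dN (y : R) : is_derive y 1 (fun h => f (- h)) (- df (- y)).
    have dM : is_derive y (1 : R) (fun h => - h : R) (- 1).
      exact: (@is_deriveN _ _ _ (id : R -> R)).
    by have := @is_derive1_comp _ f (fun h => - h) y _ _ (dF (- y)) dM; rewrite mulrN1.
  have := hw (fun h => f (- h)) (fun h => - df (- h)) (- x).
  rewrite oppr_ge0 opprK normrN; apply => //; first by rewrite oppr0.
  by move=> y; rewrite normrN -(normrN y); exact: bnd.
move=> dF f0 bnd.
have key s : `|s| = 1 -> s * f x <= x ^+ k.+1 / k.+1`!%:R.
  move=> s1.
  move: x0; rewrite le_eqVlt => /predU1P[<-|x0].
    by rewrite f0 mulr0 expr0n mul0r.
  pose g y := 1 / k.+1`!%:R * y ^+ k.+1 - s * f y.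
  have dg (y : R) : is_derive y 1 g (1 / k`!%:R * y ^+ k - s * df y).
    exact: (@is_deriveB _ _ _ _ _ y 1 _ _ (is_derive_monomial 1 y k)
      (@is_deriveZ _ _ _ f s y 1 _ (dF y))).
  have cg : continuous g.
    move=> y; apply: differentiable_continuous.
    by apply/derivable1_diffP; have [] := dg y.
  have [y] := @MVT _ g _ _ _ x0 (fun y _ => dg y) (continuous_subspaceT cg).
  rewrite in_itv /= => /andP[y0 _]; rewrite /g f0 expr0n /= !mulr0 !subr0 => E.
  have : 0 <= 1 / k`!%:R * y ^+ k - s * df y.
    rewrite subr_ge0; apply: (le_trans (ler_norm _)); rewrite normrM s1 [1 * `|_|]mul1r.
    by apply: (le_trans (bnd y)); rewrite gtr0_norm // div1r mulrC.
  by rewrite -(pmulr_lge0 _ x0) -E subr_ge0 div1r [_^-1 * _]mulrC.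
rewrite (ger0_norm x0) ler_norml; apply/andP; split.
  by rewrite lerNl -mulN1r key // normrN normr1.
by rewrite -[f x]mul1r key // normr1.
Qed.

(** The j-th derivative of the cosine at b is cos(b + j pi / 2), so the derivative of a remainder is
    the remainder of one order less at b + pi / 2. *)
Lemma cos_taylor k (b t : R) :
  `|cos (t + b) - \sum_(j < k) cos (b + j%:R * (pi / 2)) / j`!%:R * t ^+ j| <=
  `|t| ^+ k / k`!%:R.
Proof.
elim: k b t => [|k IH] b t.
  by rewrite big_ord0 subr0 expr0 fact0 divr1 cos_max.
pose F t := cos (t + b) - \sum_(j < k.+1) cos (b + j%:R * (pi / 2)) / j`!%:R * t ^+ j.
apply: (@ler_norm_derive_monomial F
  (fun t => cos (t + (b + pi / 2)) -
     \sum_(j < k) cos (b + pi / 2 + j%:R * (pi / 2)) / j`!%:R * t ^+ j)).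
- move=> x.
  have -> : F = (fun h : R => cos (1 * h + b)) - (cst (cos b) +
     \sum_(j < k) (fun h : R => cos (b + j.+1%:R * (pi / 2)) / j.+1`!%:R * h ^+ j.+1)).
    apply/funext => h; rewrite /F big_ord_recl mul0r addr0 fact0 divr1 expr0 mulr1.
    by rewrite fct_sumE !fctE mul1r.
  apply: is_deriveB.
    by have := is_derive_cos_affine 1 b x; rewrite !mul1r addrA.
  rewrite -[X in is_derive _ _ _ X]add0r; apply: is_deriveD.
  apply: is_derive_sum => j.
  rewrite (_ : b + pi / 2 + j%:R * (pi / 2) = b + j.+1%:R * (pi / 2)).
    exact: is_derive_monomial.
  by rewrite -[j.+1%:R]natr1; ring.
- rewrite /F add0r big_ord_recl mul0r addr0 fact0 divr1 expr0 mulr1 big1 ?addr0 ?subrr //.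
  by move=> j _; rewrite expr0n mulr0.
- by move=> x; exact: IH.
Qed.

(** Cauchy-Schwarz by Lagrange's identity. *)
Lemma sqr_sum_mul_le n (u v : 'I_n -> R) :
  (\sum_(i < n) u i * v i) ^+ 2 <= (\sum_(i < n) u i ^+ 2) * (\sum_(i < n) v i ^+ 2).
Proof.
rewrite -subr_ge0 -(@pmulr_rge0 _ 2) //.
have -> : 2 * ((\sum_(i < n) u i ^+ 2) * (\sum_(i < n) v i ^+ 2) - (\sum_(i < n) u i * v i) ^+ 2) =
  \sum_(i < n) \sum_(j < n) (u i * v j - u j * v i) ^+ 2.
  have E : \sum_(i < n) \sum_(j < n) (u i * v j - u j * v i) ^+ 2 =
     \sum_(i < n) \sum_(j < n) (u i ^+ 2 * v j ^+ 2) + \sum_(i < n) \sum_(j < n) (u j ^+ 2 * v i ^+ 2)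
     - 2 * \sum_(i < n) \sum_(j < n) (u i * v i * (u j * v j)).
    rewrite -big_split /= mulr_sumr -sumrB; apply: eq_bigr => i _.
    rewrite -big_split /= mulr_sumr -sumrB; apply: eq_bigr => j _; ring.
  rewrite E [X in _ + X - _]exchange_big /= expr2 !big_distrlr /=; ring.
by apply: sumr_ge0 => i _; apply: sumr_ge0 => j _; exact: sqr_ge0.
Qed.

End taylor.

(** * From vanishing moments to the observability constant *)

Section core.
Variable R : realType.

(** Every set of the filter contains one of the given frequencies, so each infimum in the supremum
    defining the lower limit is at most B. *)
Lemma liminf_observability_le d (r : R) (B : \bar R) :
  (forall M : R, exists lam, [/\ M < lam, @frequencies R d lam &
     (observability d lam r <= B)%E]) ->
  (liminf_observability d r <= B)%E.
Proof.
move=> H; rewrite /liminf_observability limf_einfE.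
apply: ge_ereal_sup => _ [V VF <-].
have [M [_ HM]] : within (@frequencies R d) (pinfty_nbhs R) V := VF.
have [lam [Mlam flam le]] := H M.
apply: le_trans le; apply: ereal_inf_lbound; exists lam => //.
exact: HM.
Qed.

Variables (D N : nat) (p : 'I_N -> 'rV[int]_D) (q : nat).
Hypothesis p_inj : injective p.
Hypothesis pq : forall j, \sum_(i < D) (p j 0 i) ^+ 2 = q%:Z.

Definition lifted_freq (n : nat) (j : 'I_N) : 'rV[int]_(1 + D) :=
  row_mx (const_mx n%:Z : 'rV_1) (p j).

Lemma lifted_freq_inj n : injective (lifted_freq n).
Proof. by move=> j l E; have [_ /p_inj] := eq_row_mx E. Qed.

Lemma lifted_freq_sq n j : \sum_(i < 1 + D) (lifted_freq n j 0 i) ^+ 2 = (n ^ 2 + q)%N%:Z.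
Proof.
rewrite big_split_ord /= big_ord1.
rewrite [lifted_freq n j 0 _](row_mxEl _ (p j)) mxE PoszD -(pq j); congr (_ + _).
by apply: eq_bigr => i _; rewrite [lifted_freq n j 0 _](row_mxEr _ (p j)).
Qed.

Lemma dotp_lifted_freqB n j l (x : 'rV[R]_(1 + D)) :
  dotp (lifted_freq n j - lifted_freq n l) x = dotp (p j - p l) (rsubmx x).
Proof.
rewrite /dotp big_split_ord /= big_ord1.
rewrite /lifted_freq opp_row_mx add_row_mx row_mxEl !mxE subrr mul0r add0r.
by apply: eq_bigr => i _; rewrite row_mxEr !mxE.
Qed.

Lemma sqmod_lifted (c : 'I_N -> R) n (x : 'rV[R]_(1 + D)) :
  sqmod (plane_waves (lifted_freq n) c x) = sqmod (plane_waves p c (rsubmx x)).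
Proof.
rewrite !sqmod_plane_waves; apply: eq_bigr => j _; apply: eq_bigr => l _.
by rewrite dotp_lifted_freqB.
Qed.

Lemma dotp_norm_le j (x : 'rV[R]_D) (r : R) : 0 <= r ->
  \sum_(i < D) x 0 i ^+ 2 <= r ^+ 2 -> `|dotp (p j) x| <= Num.sqrt q%:R * r.
Proof.
move=> r0 xr.
rewrite -(@ler_pXn2r _ 2) ?nnegrE ?mulr_ge0 ?sqrtr_ge0 // real_normK ?num_real //.
rewrite exprMn sqr_sqrtr ?ler0n //; apply: (le_trans (sqr_sum_mul_le _ _)).
rewrite (_ : \sum_(i < D) _ = q%:R) ?ler_wpM2l //.
rewrite -[q%:R]/((q%:Z)%:~R : R) -(pq j) rmorph_sum; apply: eq_bigr => i _.
by rewrite rmorphXn.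
Qed.

Variables (c : 'I_N -> R) (k : nat).
Hypothesis moments : forall (x : 'rV[R]_D) i, (i < k)%N ->
  \sum_(j < N) c j * dotp (p j) x ^+ i = 0.

(** The vanishing moments permit subtracting from every cosine its Taylor polynomial of degree less
    than k; only the remainders are left. *)
Lemma trig_moments_le (b rho : R) (x : 'rV[R]_D) :
  (forall j, `|dotp (p j) x| <= rho) ->
  `|trig p c b x| <= (\sum_(j < N) `|c j|) * (rho ^+ k / k`!%:R).
Proof.
move=> xr; rewrite /trig.
have -> : \sum_(j < N) c j * cos (dotp (p j) x + b) =
  \sum_(j < N) c j * (cos (dotp (p j) x + b) -
     \sum_(i < k) cos (b + i%:R * (pi / 2)) / i`!%:R * dotp (p j) x ^+ i).
  under [RHS]eq_bigr do rewrite mulrBr.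
  rewrite sumrB [X in _ - X](_ : _ = 0) ?subr0 //.
  under eq_bigr do rewrite mulr_sumr.
  rewrite exchange_big big1 //= => i _.
  under eq_bigr do rewrite mulrCA.
  by rewrite -mulr_sumr moments ?mulr0.
apply: (le_trans (ler_norm_sum _ _ _)); rewrite mulr_suml; apply: ler_sum => j _.
rewrite normrM ler_wpM2l //; apply: (le_trans (cos_taylor _ _ _)).
rewrite ler_wpM2r ?invr_ge0 ?ler0n // lerXn2r ?nnegrE //.
exact: le_trans (normr_ge0 _) (xr j).
Qed.

Lemma sqmod_moments_le (r : R) (x : 'rV[R]_D) : 0 <= r ->
  \sum_(i < D) x 0 i ^+ 2 <= r ^+ 2 ->
  sqmod (plane_waves p c x) <=
    2 * N%:R * ((Num.sqrt q%:R * r) ^+ k / k`!%:R) ^+ 2 * \sum_(j < N) c j ^+ 2.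
Proof.
move=> r0 xr.
have B b := @trig_moments_le b _ x (fun j => dotp_norm_le j r0 xr).
set rho := _ ^+ k / _ in B *.
(* The factor N comes from this Cauchy-Schwarz step; the factor 2 comes from adding the squares of
   the real and imaginary parts. *)
have S : (\sum_(j < N) `|c j|) ^+ 2 <= N%:R * \sum_(j < N) c j ^+ 2.
  have := sqr_sum_mul_le (fun=> 1) (fun j => `|c j|).
  under eq_bigr do rewrite mul1r.
  rewrite [X in X * _](_ : _ = N%:R); last first.
    by under eq_bigr do rewrite expr1n; rewrite sumr_const card_ord.
  by under [X in _ <= _ * X]eq_bigr do rewrite real_normK ?num_real //.
have Q b : trig p c b x ^+ 2 <= N%:R * (\sum_(j < N) c j ^+ 2) * rho ^+ 2.
  rewrite -[_ ^+ 2]real_normK ?num_real //.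
  apply: (@le_trans _ _ (((\sum_(j < N) `|c j|) * rho) ^+ 2)).
    by rewrite ler_pXn2r ?nnegrE //; apply: le_trans (B b).
  by rewrite exprMn ler_wpM2r ?sqr_ge0.
rewrite /sqmod /plane_waves /wave /=.
apply: (le_trans (lerD (Q 0) (Q (- (pi / 2))))).
by rewrite le_eqVlt; apply/orP; left; apply/eqP; ring.
Qed.

Lemma liminf_moments (r : R) : 0 <= r -> (exists j, c j != 0) ->
  (liminf_observability D.+1 r <=
    (2 * N%:R * ((Num.sqrt q%:R * r) ^+ k / k`!%:R) ^+ 2)%:E)%E.
Proof.
move=> r0 [j0 cj0]; apply: liminf_observability_le => M.
pose n := (Num.truncn `|M|).+1.
have Mn : M < n%:R by apply: (le_lt_trans (ler_norm M)); exact: truncnS_gt.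
pose lam : R := Num.sqrt (n ^ 2 + q)%N%:R.
have lam2 : lam ^+ 2 = (n ^ 2 + q)%N%:R by rewrite sqr_sqrtr ?ler0n.
have C0 : 0 < \sum_(j < N) c j ^+ 2.
  rewrite (bigD1 j0) //= ltr_pwDl ?exprn_even_gt0 //.
  by apply: sumr_ge0 => j _; exact: sqr_ge0.
have eig : @laplace_eigenspace R D.+1 lam (plane_waves (lifted_freq n) c).
  apply: (@wave_eigen _ _ _ _ _ _ _ _ (n ^ 2 + q)%N%:Z) => // j.
  exact: lifted_freq_sq.
have av := average_torus_plane_waves c (@lifted_freq_inj n).
(* The zero function would have average zero over the torus, against Parseval's identity. *)
have ne : plane_waves (lifted_freq n) c <> (fun=> 0).
  move=> E; move: C0; rewrite -av E /average.
  have -> : @sqmod R \o (fun=> 0) = (fun=> 0) :> ('rV[R]_D.+1 -> R).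
    by apply/funext => x; rewrite /sqmod /= expr0n addr0.
  by rewrite /Rintegral integral0 /= mulr0 ltxx.
exists lam; split.
- apply: (lt_le_trans Mn); rewrite -(@ger0_norm _ (n%:R : R)) //.
  by rewrite -sqrtr_sqr ler_wsqrtr // -natrX ler_nat leq_addr.
- by split; [exact: sqrtr_ge0|exists (n ^ 2 + q)%N|exists (plane_waves (lifted_freq n) c)].
apply: (@le_trans _ _ (average (@eball R D.+1 r) (@sqmod R \o plane_waves (lifted_freq n) c) /
   average (@torus_cell R D.+1) (@sqmod R \o plane_waves (lifted_freq n) c))%:E).
  by apply: ereal_inf_lbound; exists (plane_waves (lifted_freq n) c).
rewrite lee_fin av ler_pdivrMr //; apply: average_ball_plane_waves_le.
  by rewrite mulr_ge0 ?(ltW C0) // mulr_ge0 ?sqr_ge0 // mulr_ge0 ?ler0n.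
move=> x xr; rewrite (sqmod_lifted c n x); apply: sqmod_moments_le => //.
move: xr; rewrite /eball /= => xr.
have x0 : 0 <= \sum_(i < D.+1) x 0 i ^+ 2 by apply: sumr_ge0 => i _; exact: sqr_ge0.
apply: (@le_trans _ _ (\sum_(i < D.+1) x 0 i ^+ 2)).
  rewrite -[D.+1]/(1 + D)%N big_split_ord /= big_ord1.
  rewrite [leLHS](eq_bigr (fun i => x 0 (rshift 1 i) ^+ 2)).
    by rewrite lerDr sqr_ge0.
  by move=> i _; rewrite mxE.
rewrite -(sqr_sqrtr x0) ler_pXn2r ?nnegrE ?sqrtr_ge0 //; exact: ltW.
Qed.

End core.

(** * Monomials on a sphere and vanishing moments *)

Section moments.
Variables (R : realType) (D N k q : nat) (p : 'I_N -> 'rV[int]_D.+1).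
Hypothesis pq : forall j, \sum_(i < D.+1) (p j 0 i) ^+ 2 = q%:Z.
Local Notation P j i := ((p j 0 i)%:~R : R).

(** The degree in the first coordinate is at most one, since on the sphere its square is q minus the
    other squares. *)
Definition sphere_monomial (e : bool) (al : 'I_D -> nat) (j : 'I_N) : R :=
  P j ord0 ^+ e * \prod_(i < D) P j (lift ord0 i) ^+ al i.

Let incr (al : 'I_D -> nat) (s : 'I_D) := fun i => (al i + (i == s))%N.

Lemma sphere_monomial_incr e al s j :
  sphere_monomial e (incr al s) j = P j (lift ord0 s) * sphere_monomial e al j.
Proof.
rewrite /sphere_monomial mulrCA; congr (_ * _).
rewrite (bigD1 s) //= [in RHS](bigD1 s) //= mulrA; congr (_ * _).
  by rewrite /incr eqxx addn1 exprS.
by apply: eq_bigr => i /negPf ni; rewrite /incr ni addn0.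
Qed.

Lemma sum_incr al s : (\sum_i incr al s i = (\sum_i al i).+1)%N.
Proof.
rewrite big_split /= -[RHS]addn1; congr addn.
by rewrite (bigD1 s) //= eqxx big1 ?addn0 // => i /negPf ->.
Qed.

Lemma sphere_monomial_sq al j :
  P j ord0 * sphere_monomial true al j =
  q%:R * sphere_monomial false al j -
  \sum_(s < D) sphere_monomial false (incr (incr al s) s) j.
Proof.
under eq_bigr do rewrite !sphere_monomial_incr mulrA.
rewrite -mulr_suml -mulrBl /sphere_monomial expr1 expr0 mul1r mulrA; congr (_ * _).
apply/eqP; rewrite eq_sym subr_eq eq_sym; apply/eqP.
rewrite -[q%:R]/((q%:Z)%:~R : R) -(pq j) big_ord_recl rmorphD rmorphXn rmorph_sum.
by congr (_ + _); apply: eq_bigr => i _; rewrite rmorphXn.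
Qed.

(** Induction on i: one factor of the power is expanded and absorbed into the monomial. A square of
    the first coordinate is removed by [sphere_monomial_sq], which does not raise the total
    degree. *)
Lemma moments_of_monomials (c : 'I_N -> R) :
  (forall (e : bool) al, (e + \sum_i al i < k)%N ->
    \sum_(j < N) c j * sphere_monomial e al j = 0) ->
  forall (x : 'rV[R]_D.+1) i, (i < k)%N -> \sum_(j < N) c j * dotp (p j) x ^+ i = 0.
Proof.
move=> c0 x.
suff H : forall i (e : bool) al, (i + e + \sum_i al i < k)%N ->
    \sum_(j < N) c j * (dotp (p j) x ^+ i * sphere_monomial e al j) = 0.
  move=> i ik; have := H i false (fun=> 0%N).
  rewrite big1 // !addn0 => /(_ ik); apply: etrans; apply: eq_bigr => j _.
  by rewrite /sphere_monomial expr0 mul1r big1 ?mulr1.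
elim=> [|i IH] e al lt.
  under eq_bigr do rewrite expr0 mul1r; exact: c0.
have -> : \sum_(j < N) c j * (dotp (p j) x ^+ i.+1 * sphere_monomial e al j) =
   \sum_(s < D.+1) x 0 s * (\sum_(j < N) c j * (dotp (p j) x ^+ i * (P j s * sphere_monomial e al j))).
  under [RHS]eq_bigr do rewrite mulr_sumr.
  rewrite exchange_big; apply: eq_bigr => j _ /=.
  rewrite exprSr [X in _ ^+ _ * X]/dotp mulr_sumr mulr_suml mulr_sumr.
  by apply: eq_bigr => s _; ring.
apply: big1 => s _; apply/eqP; rewrite mulf_eq0; apply/orP; right; apply/eqP.
case: (unliftP ord0 s) => [s' ->|->].
  under eq_bigr do rewrite -sphere_monomial_incr.
  by apply: IH; rewrite sum_incr; move: lt; rewrite addnS !addSn.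
case: e lt => lt.
  under eq_bigr do rewrite sphere_monomial_sq.
  have E0 := IH false al; rewrite addn0 in E0.
  have E s' := IH false (incr (incr al s') s').
  transitivity (q%:R * (\sum_(j < N) c j * (dotp (p j) x ^+ i * sphere_monomial false al j)) -
    \sum_(s < D) \sum_(j < N) c j * (dotp (p j) x ^+ i * sphere_monomial false (incr (incr al s) s) j)).
    rewrite mulr_sumr exchange_big -sumrB; apply: eq_bigr => j _ /=.
    rewrite mulrBr mulrBr !mulr_sumr; congr (_ - _); ring.
  rewrite E0; last by lia.
  rewrite mulr0 sub0r big1 ?oppr0 // => s' _; apply: E.
  by rewrite !sum_incr addn0; lia.
rewrite -[RHS](IH true al); last by lia.
apply: eq_bigr => j _; congr (_ * (_ * _)).
by rewrite /sphere_monomial expr0 mul1r.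
Qed.

(** There are 2 k^D pairs of a Boolean and exponents below k, so the homogeneous system has more
    unknowns than equations. *)
Lemma exists_moments : (2 * k ^ D < N)%N -> exists c : 'I_N -> R,
  (exists j, c j != 0) /\
  forall (x : 'rV[R]_D.+1) i, (i < k)%N -> \sum_(j < N) c j * dotp (p j) x ^+ i = 0.
Proof.
move=> kN; pose E := (bool * {ffun 'I_D -> 'I_k})%type.
pose A : 'M[R]_(N, #|{: E}|) := \matrix_(j, e)
  sphere_monomial (enum_val e : E).1 (fun i => (enum_val e : E).2 i : nat) j.
have cardE : #|{: E}| = (2 * k ^ D)%N by rewrite card_prod card_bool card_ffun !card_ord.
have ker0 : kermx A != 0.
  rewrite -mxrank_eq0 mxrank_ker subn_eq0 -ltnNge.
  by apply: leq_ltn_trans (rank_leq_col A) _; rewrite cardE.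
pose c := nz_row (kermx A).
have cA : c *m A = 0 by apply/sub_kermxP; exact: nz_row_sub.
have [j cj] : exists j, c 0 j != 0.
  apply/existsP; apply: contraNT ker0 => /existsPn H; rewrite -nz_row_eq0.
  by apply/eqP/rowP => j; rewrite mxE; apply/eqP; move: (H j); rewrite negbK.
exists (c 0); split; first by exists j.
apply: moments_of_monomials => b al lt.
have alk i : (al i < k)%N.
  apply: leq_ltn_trans lt; rewrite (bigD1 i) //=; lia.
pose e : E := (b, [ffun i => Ordinal (alk i)]).
have := congr1 (fun M : 'rV_(_) => M 0 (enum_rank e)) cA.
rewrite mxE [RHS]mxE => h; rewrite -[RHS]h.
apply: eq_bigr => l _; rewrite mxE enum_rankK /=; congr (_ * (_ * _)).
by apply: eq_bigr => i _; rewrite ffunE.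
Qed.

End moments.

(** * From lattice points on a sphere to exponential smallness *)

Section bounds.
Variable R : realType.
Implicit Types r : R.

(** A single zero frequency with k = 0, so that there are no moments to kill. This crude bound
    covers the values of r that the constructions do not reach. *)
Lemma liminf_observability_le2 d r : 0 <= r ->
  (liminf_observability d.+1 r <= (2 : R)%:E)%E.
Proof.
move=> r0; have := @liminf_moments R d 1 (fun=> 0) 0 _ _ (fun=> 1) 0 _ r r0 _.
rewrite expr0 divr1 expr1n !mulr1; apply.
- by move=> i j _; rewrite !ord1.
- by move=> j; apply: big1 => i _; rewrite mxE expr0n.
- by [].
- by exists ord0; rewrite oner_neq0.
Qed.

Lemma liminf_observability2_le r : 0 <= r ->
  (liminf_observability 2 r <= (4 * r ^+ 2)%:E)%E.
Proof.
move=> r0.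
pose p (j : 'I_2) : 'rV[int]_1 := const_mx (if j == ord0 then 1 else -1).
pose c (j : 'I_2) : R := if j == ord0 then 1 else -1.
have := @liminf_moments R 1 2 p 1 _ _ c 1 _ r r0 _.
rewrite sqrtr1 mul1r expr1 factS fact0 muln1 divr1 -natrM; apply.
- move=> i j /rowP/(_ ord0); rewrite !mxE.
  by case: (unliftP ord0 i) (unliftP ord0 j) => [i' ->|->] [j' ->|->] //= _;
    rewrite !ord1.
- by move=> j; rewrite big_ord1 mxE; case: ifP.
- move=> x [|//] _; rewrite big_ord_recl big_ord1 !expr0 !mulr1.
  by rewrite /c /= subrr.
- by exists ord0; rewrite /c eqxx oner_neq0.
Qed.

Lemma expn_fact_le_expR (x : R) n : 0 <= x -> x ^+ n / n`!%:R <= expR x.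
Proof.
move=> x0; case: n => [|n].
  by rewrite expr0 fact0 divr1 -expR0 ler_expR.
by apply: le_trans (expR_ge1Dxn n x0); rewrite lerDr.
Qed.

(** Since k^k / k! <= e^k, the hypothesis on r makes the Taylor factor at most e^(-k) and its square
    at most e^(-2 k). The number of frequencies is at most 3 D! e^k and uses up one of the two
    factors. *)
Lemma liminf_points (D k q : nat) (s : seq 'rV[int]_D.+1) r : 0 <= r ->
  uniq s -> (2 * k ^ D < size s)%N ->
  (forall v, v \in s -> \sum_(i < D.+1) v 0 i ^+ 2 = q%:Z) ->
  Num.sqrt q%:R * r <= expR (- 2) * k%:R ->
  (liminf_observability D.+2 r <= (6 * D`!%:R * expR (- k%:R))%:E)%E.
Proof.
move=> r0 Us ks sq qr.
(* No more points are kept than the dimension count needs, as N enters the bound. *)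
pose N := (2 * k ^ D).+1.
pose p (j : 'I_N) : 'rV[int]_D.+1 := nth 0 s j.
have js (j : 'I_N) : (j < size s)%N by apply: leq_trans ks; exact: ltn_ord.
have p_inj : injective p.
  by move=> i j /eqP; rewrite nth_uniq // => /eqP/val_inj.
have pq j : \sum_(i < D.+1) (p j 0 i) ^+ 2 = q%:Z by apply: sq; exact: mem_nth.
have [c [c0 mom]] := @exists_moments R D N k q p pq (ltnSn _).
apply: (le_trans (liminf_moments p_inj pq mom r0 c0)); rewrite lee_fin.
have e0 : 0 <= Num.sqrt q%:R * r by rewrite mulr_ge0 ?sqrtr_ge0.
have E1 : (Num.sqrt q%:R * r) ^+ k / k`!%:R <= expR (- k%:R).
  apply: (@le_trans _ _ ((expR (- 2) * k%:R) ^+ k / k`!%:R)).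
    by rewrite ler_wpM2r ?invr_ge0 ?ler0n // lerXn2r ?nnegrE // (le_trans e0).
  rewrite exprMn -mulrA.
  apply: (@le_trans _ _ (expR (- 2) ^+ k * expR k%:R)).
    by rewrite ler_wpM2l ?exprn_ge0 ?expR_ge0 // expn_fact_le_expR.
  by rewrite -expRM_natl -expRD ler_expR; lra.
have E2 : ((Num.sqrt q%:R * r) ^+ k / k`!%:R) ^+ 2 <= expR (- k%:R) * expR (- k%:R).
  by rewrite expr2 ler_pM // mulr_ge0 ?exprn_ge0 ?invr_ge0.
have D1 : 1 <= D`!%:R :> R by rewrite ler1n fact_gt0.
have E3 : k%:R ^+ D <= D`!%:R * expR k%:R :> R.
  by rewrite mulrC -ler_pdivrMr ?(lt_le_trans ltr01) // expn_fact_le_expR.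
have E4 : 1 <= D`!%:R * expR k%:R :> R.
  have ek : 1 <= expR k%:R :> R by apply: le_trans (expR_ge1Dx _); rewrite lerDl.
  by apply: (le_trans D1); rewrite ler_peMr // ler0n.
have NE : N%:R <= 3 * (D`!%:R * expR k%:R) :> R.
  rewrite /N -natr1 natrM natrX; lra.
apply: (@le_trans _ _ (2 * (3 * (D`!%:R * expR k%:R)) * (expR (- k%:R) * expR (- k%:R)))).
  apply: ler_pM => //; first exact: sqr_ge0.
  by rewrite ler_wpM2l.
rewrite le_eqVlt; apply/orP; left; apply/eqP.
have : expR k%:R * expR (- k%:R) = 1 :> R by rewrite -expRD subrr expR0.
move: (expR k%:R) (expR (- k%:R)) => u v uv.
by transitivity (6 * D`!%:R * v * (u * v)); [ring|rewrite uv mulr1].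
Qed.

End bounds.

(** * The bounds in each dimension *)

(** Pigeonhole: the m^(D+1) points with coordinates in [0, m) have fewer possible squared norms than
    (D + 1) m^2 + 1. *)
Lemma many_sphere_points D m K : (D.+1 * m ^ 2 * K < m ^ D.+1)%N ->
  exists q (s : seq 'rV[int]_D.+1), [/\ (q <= D.+1 * m ^ 2)%N, uniq s, (K < size s)%N &
    forall v, v \in s -> \sum_(i < D.+1) v 0 i ^+ 2 = q%:Z].
Proof.
move=> lt; have m0 : (0 < m)%N by rewrite lt0n; apply/eqP => m0; rewrite m0 !exp0n in lt.
pose Q := (D.+1 * m ^ 2)%N.
have Q0 : (0 < Q)%N by rewrite muln_gt0 expn_gt0 m0.
pose F := {ffun 'I_D.+1 -> 'I_m}.
pose h (f : F) := (\sum_i (f i) ^ 2)%N.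
have hQ f : (h f < Q)%N.
  apply: (@leq_trans (\sum_(i < D.+1) ((f i) ^ 2 + 1))%N).
    by rewrite big_split /= sum_nat_const card_ord muln1 addnS ltnS leq_addr.
  apply: (@leq_trans (\sum_(i < D.+1) m ^ 2)%N); last first.
    by rewrite sum_nat_const card_ord.
  by apply: leq_sum => i _; rewrite addn1 ltn_exp2r.
pose g f : 'I_Q := Ordinal (hQ f).
have [q Kq] : exists q, (K < #|[pred f | g f == q]|)%N.
  apply/existsP; apply: contraLR lt => /existsPn H; rewrite -leqNgt -/Q.
  have -> : (m ^ D.+1 = #|{: F}|)%N by rewrite card_ffun !card_ord.
  rewrite -sum1_card (partition_big g predT) //=.
  apply: (@leq_trans (\sum_(q < Q) K)%N); last by rewrite sum_nat_const card_ord.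
  by apply: leq_sum => q _; rewrite sum1_card leqNgt; exact: H.
pose v (f : F) : 'rV[int]_D.+1 := \row_i (f i)%:Z.
have v_inj : injective v.
  move=> f f' /rowP E; apply/ffunP => i; apply: val_inj.
  by have := E i; rewrite !mxE => -[].
exists q, [seq v f | f <- enum [pred f | g f == q]]; split.
- exact: ltnW.
- by rewrite map_inj_uniq // enum_uniq.
- by rewrite size_map -cardE.
- move=> w /mapP[f]; rewrite mem_enum inE => /eqP <- ->.
  rewrite /= /h -natz natr_sum; apply: eq_bigr => i _.
  by rewrite mxE natrX natz.
Qed.

(** * Dimension at least four *)

Section asymptotics.
Variable R : realType.

(** This trades the prefactor A, which will depend on the dimension, for a smaller rate. If c0 x <=
    2 (1 + A) the new exponent is at least -1 and the bound 2 suffices; otherwise A <= e^A is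
    absorbed by half of the decay. *)
Lemma min_expR_le (A c0 x y : R) : 0 < A -> 0 < c0 -> 0 <= x ->
  y <= 2 -> y <= A * expR (- (c0 * x)) ->
  y <= 2 * expR 1 * expR (- (c0 / (2 * (1 + A)) * x)).
Proof.
move=> A0 c00 x0 y2 yA.
have A1 : 0 < 2 * (1 + A) by lra.
have Ae : A <= expR A by apply: le_trans (expR_ge1Dx _); lra.
have e1 : 2 <= 2 * expR 1 :> R.
  have := expR_ge1Dx (1 : R); lra.
have [le|lt] := leP (c0 * x) (2 * (1 + A)).
  apply: (le_trans y2); rewrite -mulrA -expRD.
  rewrite -[leLHS]mulr1 ler_wpM2l // -[leLHS](@expR0 R) ler_expR subr_ge0.
  by rewrite mulrAC ler_pdivrMr // mul1r.
apply: (le_trans yA); apply: (@le_trans _ _ (expR A * expR (- (c0 * x)))).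
  by rewrite ler_wpM2r ?expR_ge0.
rewrite -expRD; apply: (@le_trans _ _ (expR (- (c0 / (2 * (1 + A)) * x)))).
  rewrite ler_expR.
  have : c0 / (2 * (1 + A)) * x <= c0 * x / 2.
    rewrite mulrAC; apply: ler_wpM2l; first by rewrite mulr_ge0 // ltW.
    by rewrite lef_pV2 ?posrE //; lra.
  lra.
by rewrite ler_peMl ?expR_ge0 //; lra.
Qed.

Lemma liminf_high_dim (E : nat) : (0 < E)%N -> exists2 A : R, 0 < A & exists2 c0 : R, 0 < c0 &
  forall r : R, 0 < r < 1 ->
    (liminf_observability E.+3 r <= (A * expR (- (c0 * (r ^+ E)^-1)))%:E)%E.
Proof.
(* Chosen so that 3 (E + 2)^2 a^(E+1) r <= e^(-2) a^E as soon as a r <= kappa. *)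
move=> E0; pose kappa : R := expR (- 2) / (3 * E.+2%:R ^+ 2).
have kap0 : 0 < kappa by rewrite divr_gt0 ?expR_gt0 // mulr_gt0 // exprn_gt0.
have F1 : 1 <= (E.+1)`!%:R :> R by rewrite ler1n fact_gt0.
exists (6 * (E.+1)`!%:R + 2 * expR 1).
  by have := expR_gt0 (1 : R); lra.
exists ((kappa / 2) ^+ E); first by rewrite exprn_gt0 // divr_gt0.
move=> r /andP[r0 r1].
(* For r > kappa the exponent is at least -1, and the summand 2 e of the prefactor makes the crude
   bound sufficient. *)
have [rk|kr] := leP r kappa; last first.
  apply: le_trans (liminf_observability_le2 _ (ltW r0)) _; rewrite lee_fin.
  rewrite -exprVn -exprMn.
  have h : (kappa / 2 * r^-1) ^+ E <= 1.
    rewrite exprn_ile1 // ?mulr_ge0 ?invr_ge0 ?(ltW r0) ?(ltW kap0) //.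
    by rewrite ler_pdivrMr // mul1r; lra.
  apply: (@le_trans _ _ (2 * expR 1 * expR (- 1))).
    by rewrite -mulrA -expRD subrr expR0 mulr1.
  apply: ler_pM; rewrite ?mulr_ge0 ?expR_ge0 //; last by rewrite ler_expR lerN2.
  lra.
pose a := Num.truncn (kappa / r).
have kr1 : 1 <= kappa / r by rewrite ler_pdivlMr // mul1r.
have /andP[a1 a2] : (a%:R <= kappa / r < a.+1%:R).
  by apply: truncn_itv; lra.
have a0 : (0 < a)%N by rewrite /a truncn_gt0.
have ah : kappa / 2 / r <= a%:R :> R.
  have : 1 <= a%:R :> R by rewrite ler1n.
  by move: a2; rewrite -[a.+1%:R]natr1 [kappa / 2 / r]mulrAC; lra.
(* With k = a^E the count needs 2 (E + 2) a^(E (E+1)) < m^E; the factor 3 (E + 2) ensures it because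
   E > 0. *)
pose m := (3 * E.+2 * a ^ E.+1)%N.
have cnt : (E.+2 * m ^ 2 * (2 * (a ^ E) ^ E.+1) < m ^ E.+2)%N.
  have -> : (m ^ E.+2 = m ^ 2 * m ^ E)%N by rewrite -expnD.
  rewrite mulnAC [ltnLHS]mulnC ltn_pmul2l; last by rewrite expn_gt0 !muln_gt0 expn_gt0 a0.
  rewrite /m expnMn -!expnM (mulnC E.+1) mulnA ltn_pmul2r ?expn_gt0 ?a0 //.
  rewrite -[E in ltnRHS](prednK E0) expnS.
  have : (0 < (3 * E.+2) ^ E.-1)%N by rewrite expn_gt0.
  by move: (_ ^ E.-1)%N => z; nia.
have [q [s [qm Us ks sq]]] := many_sphere_points cnt.
have qr : Num.sqrt q%:R * r <= expR (- 2) * (a ^ E)%:R.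
  have sqq : Num.sqrt q%:R <= E.+2%:R * m%:R :> R.
    rewrite -(@ler_pXn2r _ 2) ?nnegrE ?sqrtr_ge0 // sqr_sqrtr ?ler0n //.
    rewrite -natrM -natrX ler_nat; apply: (leq_trans qm).
    by rewrite expnMn leq_mul2r; apply/orP; right; nia.
  apply: (@le_trans _ _ (E.+2%:R * m%:R * r)); first by rewrite ler_wpM2r // ltW.
  have ar : a%:R * r <= kappa by rewrite -ler_pdivlMr.
  have E3 : 0 < 3 * E.+2%:R ^+ 2 :> R by rewrite mulr_gt0 // exprn_gt0.
  have -> : expR (- 2) = 3 * E.+2%:R ^+ 2 * kappa :> R.
    by rewrite /kappa mulrC divfK // gt_eqF.
  rewrite /m !natrM !natrX exprS.
  have E4 : 0 <= 3 * E.+2%:R ^+ 2 * a%:R ^+ E :> R by rewrite mulr_ge0 ?exprn_ge0 // ltW.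
  apply: (le_trans _ (le_trans (ler_wpM2l E4 ar) _));
    by rewrite le_eqVlt; apply/orP; left; apply/eqP; ring.
apply: (le_trans (liminf_points (ltW r0) Us ks sq qr)); rewrite lee_fin.
apply: ler_pM; rewrite ?mulr_ge0 ?expR_ge0 //; first by rewrite lerDl mulr_ge0 ?expR_ge0.
rewrite ler_expR lerN2 natrX -exprVn -exprMn lerXn2r ?nnegrE //.
by rewrite mulr_ge0 ?invr_ge0 ?divr_ge0 ?(ltW r0) ?(ltW kap0).
Qed.

End asymptotics.

(** * Dimension three *)

Section dim3.
Variable R : realType.

Definition row_of_pair (ab : int * int) : 'rV[int]_2 :=
  \row_i (if i == ord0 then ab.1 else ab.2).

Lemma row_of_pair_inj : injective row_of_pair.
Proof.
move=> [a b] [a' b'] /rowP E; have := E ord0; have := E (lift ord0 ord0).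
by rewrite !mxE /= => -> ->.
Qed.

(** Here k = 2^t, and the 2^(t+2) points given by t + 2 primes exceed the required 2 k. For t >= 3
    the bound on n simplifies to (60 t)^(134 t), and then sqrt(n) r <= 1 <= e^(-2) t <= e^(-2) k. *)
Lemma liminf_circle (r : R) (t : nat) : 0 < r -> (2 < t)%N -> expR 2 <= t%:R :> R ->
  ((60 * t) ^ (134 * t))%N%:R * r ^+ 2 <= 1 ->
  (liminf_observability 3 r <= (6 * expR (- (2 ^ t)%N%:R))%:E)%E.
Proof.
move=> r0 t3 et nr.
have [n [s [nB Us szs sn]]] := @many_circle_points t.+2 isT.
have Ul : uniq (map row_of_pair s) by rewrite map_inj_uniq //; exact: row_of_pair_inj.
have sl : (2 * (2 ^ t) ^ 1 < size (map row_of_pair s))%N.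
  by rewrite size_map szs expn1 -expnS ltn_exp2l.
have sq v : v \in map row_of_pair s -> \sum_(i < 2) v 0 i ^+ 2 = n%:Z.
  by case/mapP => ab /sn E ->; rewrite -E big_ord_recl big_ord1 !mxE.
have nB' : (n <= (60 * t) ^ (134 * t))%N.
  have pw x z e f : (x <= z -> e <= f -> 0 < z -> x ^ e <= z ^ f)%N.
    move=> xz ef z0; apply: (@leq_trans (z ^ e)); last by rewrite leq_pexp2l.
    by case: e {ef} => // e; rewrite leq_exp2r.
  have h1 : (30 * t.+3 <= 60 * t)%N by lia.
  have h2 : (67 * t.+2 <= 134 * t)%N by lia.
  have h3 : (0 < 60 * t)%N by lia.
  exact: leq_trans nB (pw _ _ _ _ h1 h2 h3).
have qr : Num.sqrt n%:R * r <= expR (- 2) * (2 ^ t)%N%:R.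
  apply: (@le_trans _ _ 1).
    rewrite -(@ler_pXn2r _ 2) ?nnegrE ?mulr_ge0 ?sqrtr_ge0 ?(ltW r0) //.
    rewrite exprMn sqr_sqrtr ?ler0n // expr1n; apply: le_trans nr.
    by rewrite ler_wpM2r ?sqr_ge0 // ler_nat.
  rewrite expRN mulrC ler_pdivlMr ?expR_gt0 // mul1r; apply: (le_trans et).
  by rewrite ler_nat ltnW // ltn_expl.
have := liminf_points (ltW r0) Ul sl sq qr.
by rewrite factS fact0 muln1 mulr1.
Qed.

Lemma liminf_dim3 : exists2 C : R, 0 < C & exists2 Y0 : R, 0 < Y0 &
  forall r : R, 0 < r -> expR 1 <= ln (1 / r) -> Y0 <= ln (1 / r) / ln (ln (1 / r)) ->
  (liminf_observability 3 r <=
     (6 * expR (- expR (C * (ln (1 / r) / ln (ln (1 / r))))))%:E)%E.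
Proof.
have ln2 : 0 < ln (2 : R) by rewrite ln_gt0 // ltr1n.
pose t0 : R := expR 2 + 3.
have t00 : 0 < t0 by rewrite addr_gt0 // expR_gt0.
exists (ln 2 / 134); first by rewrite divr_gt0.
exists (134 * t0); first by rewrite mulr_gt0.
move=> r r0; set L := ln (1 / r); set y := L / ln L => eL Yy.
have L0 : 0 < L by apply: lt_le_trans eL; exact: expR_gt0.
have lnL1 : 1 <= ln L by rewrite -(expRK (1 : R)) ler_ln ?posrE ?expR_gt0.
have lnL0 : 0 < ln L by lra.
have yL : y <= L by rewrite ler_pdivrMr // ler_peMr // ltW.
(* As 60 t <= L, the radius condition follows from 134 t ln L <= 2 L, that is t <= y / 67. Rounding
   down keeps t >= y / 134, whence the constant ln 2 / 134. *)
pose t := Num.truncn (y / 67).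
have /andP[t1 t2] : (t%:R <= y / 67 < t.+1%:R) by apply: truncn_itv; lra.
rewrite -[t.+1%:R]natr1 in t2.
have ty : y / 134 <= t%:R.
  have : 1 <= t%:R :> R; last by lra.
  rewrite ler1n /t truncn_gt0; have := expR_gt0 (2 : R); rewrite /t0 in Yy; lra.
have tt0 : t0 <= t%:R by lra.
have t3 : (2 < t)%N.
  rewrite -(@ltr_nat R); apply: lt_le_trans tt0; have := expR_gt0 (2 : R).
  by rewrite /t0; lra.
apply: (le_trans (liminf_circle r0 t3 _ _)).
- by apply: le_trans tt0; rewrite lerDl.
- rewrite natrX; apply: (@le_trans _ _ (L ^+ (134 * t) * r ^+ 2)).
    rewrite ler_wpM2r ?sqr_ge0 // lerXn2r ?nnegrE ?(ltW L0) // natrM; lra.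
  have -> : L ^+ (134 * t) = expR ((134 * t)%N%:R * ln L) by rewrite expRM_natl lnK.
  have -> : r ^+ 2 = expR (2%:R * - L).
    by rewrite expRM_natl /L -lnV ?posrE ?divr_gt0 // div1r invrK lnK.
  rewrite -expRD -[leRHS](@expR0 R) ler_expR natrM.
  have : t%:R * ln L <= L / 67.
    by rewrite -ler_pdivlMr // mulrAC.
  lra.
rewrite lee_fin ler_wpM2l // ler_expR lerN2 natrX.
have -> : (2 : R) ^+ t = expR (t%:R * ln 2) by rewrite expRM_natl lnK // posrE.
rewrite ler_expR mulrAC -mulrA mulrC; rewrite ler_wpM2r ?(ltW ln2) //.
Qed.

End dim3.

(** In dimension three, ln(ln(1/r)) decreases to 0 as r increases to 1/e, so the right-hand side
    tends to 0 there for fixed K. Hence r stays below some r0 < 1/e or above 1/e, and K is chosen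
    after r0, whereas C is not. *)
Theorem theorem2p3 (R : realType) :
  (exists2 K : R, 0 < K & forall r : R, 0 < r < 1 ->
     (liminf_observability 2 r <= (K * r ^+ 2)%:E)%E) /\
  (exists2 C : R, 0 < C & forall r0 : R, 0 < r0 < expR (- 1) ->
     exists2 K : R, 0 < K & forall r : R, 0 < r < 1 ->
       r <= r0 \/ expR (- 1) < r ->
       (liminf_observability 3 r <=
          (K * expR (- expR (C * ln (1 / r) / ln (ln (1 / r)))))%:E)%E) /\
  (exists2 K : R, 0 < K & forall d : nat, (4 <= d)%N ->
     exists2 C : R, 0 < C & forall r : R, 0 < r < 1 ->
       (liminf_observability d r <=
          (K * expR (- (C * r ^ (3%:Z - d%:Z))))%:E)%E).
Proof.
split; first by exists 4 => // r /andP[r0 _]; exact/liminf_observability2_le/ltW.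
split.
  have [C C0 [Y0 Y00 H]] := liminf_dim3 R.
  exists C => // r0 /andP[r00 r0e].
  pose L0 := ln (1 / r0).
  have L01 : 1 < L0.
    rewrite /L0 div1r lnV ?posrE // ltrNr -(expRK (- 1 : R)).
    by rewrite ltr_ln ?posrE ?expR_gt0.
  have lnL0 : 0 < ln L0 by rewrite ln_gt0.
  (* For L0 <= L < e the quotient L / ln L is at most e / ln L0, and for L < 1 it is negative; so a
     quotient of at least Y forces L >= e. *)
  pose Y := Y0 + expR 1 / ln L0.
  have Y1 : 0 < expR 1 / ln L0 by rewrite divr_gt0 ?expR_gt0.
  (* The second summand makes the right-hand side at least 2 when L / ln L < Y, where the crude
     bound is used. *)
  pose K := 6 + 2 * expR (expR (C * Y)).
  have K6 : 6 <= K by have := expR_gt0 (expR (C * Y)); rewrite /K; lra.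
  exists K; first by lra.
  move=> r /andP[rpos r1] rr0; rewrite -mulrA; set L := ln (1 / r).
  have Lpos : 0 < L by rewrite ln_gt0 // div1r invf_gt1.
  have [yY|yY] := leP Y (L / ln L).
    have eL : expR 1 <= L.
      rewrite leNgt; apply/negP => Le; move: yY; apply/negP; rewrite -ltNge.
      have [rr|rr] := rr0.
        have LL : L0 <= L by rewrite ler_ln ?posrE ?divr_gt0 // !div1r lef_pV2 ?posrE.
        have lnLL : ln L0 <= ln L by rewrite ler_ln ?posrE //; lra.
        apply: (@le_lt_trans _ _ (expR 1 / ln L0)); last by rewrite /Y; lra.
        apply: ler_pM; rewrite ?invr_ge0 ?(ltW Le) ?(ltW Lpos) //; first lra.
        by rewrite lef_pV2 ?posrE //; lra.
      have L1 : L < 1.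
        rewrite /L div1r lnV ?posrE // ltrNl -(expRK (- 1 : R)).
        by rewrite ltr_ln ?posrE ?expR_gt0.
      have lnLn : ln L < 0 by rewrite ln_lt0 // Lpos.
      apply: (@le_lt_trans _ _ 0); last by rewrite /Y; lra.
      by rewrite mulr_ge0_le0 ?(ltW Lpos) // invr_le0 ltW.
    apply: (le_trans (H r rpos eL _)).
      by apply: le_trans yY; rewrite /Y; lra.
    by rewrite lee_fin ler_wpM2r ?expR_ge0.
  apply: le_trans (liminf_observability_le2 _ (ltW rpos)) _; rewrite lee_fin.
  apply: (@le_trans _ _ (2 * expR (expR (C * Y)) * expR (- expR (C * (L / ln L))))).
    rewrite -mulrA -expRD -[leLHS]mulr1 ler_wpM2l // -[leLHS](@expR0 R) ler_expR.
    by rewrite subr_ge0 ler_expR ler_wpM2l // ltW.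
  by rewrite ler_wpM2r ?expR_ge0 // /K; lra.
exists (2 * expR 1); first by rewrite mulr_gt0 // expR_gt0.
move=> d d4; have [E -> E0] : exists2 E, d = E.+3 & (0 < E)%N.
  by exists (d - 3)%N; lia.
have [A A0 [c0 c00 H]] := liminf_high_dim R E0.
exists (c0 / (2 * (1 + A))); first by rewrite divr_gt0 // mulr_gt0 //; lra.
move=> r r01; have /andP[r0 r1] := r01.
have -> : r ^ (3%:Z - E.+3%:Z) = (r ^+ E)^-1.
  have -> : 3%:Z - E.+3%:Z = - E%:Z by lia.
  by rewrite -exprnN.
have h2 := @liminf_observability_le2 R E.+2 r (ltW r0).
have hA := H r r01.
(* The smaller of the two upper bounds satisfies both hypotheses of [min_expR_le], whose prefactor 2
   e is free of d. *)
have [B1|B2] := leP (2 : R) (A * expR (- (c0 * (r ^+ E)^-1))).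
  apply: (le_trans h2); rewrite lee_fin; apply: min_expR_le => //.
  by rewrite invr_ge0 exprn_ge0 // ltW.
apply: (le_trans hA); rewrite lee_fin; apply: min_expR_le => //.
  by rewrite invr_ge0 exprn_ge0 // ltW.
exact: ltW.
Qed.
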